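(* For every tree poset $P$ of height $k\geq2$ and every $\varepsilon>0$, there exists a constant $K=K(\varepsilon,P)>0$ such that for every sufficiently large $n$ there is a fingerprint $(\mathcal{T},g,C)$ of $\mathcal{G}_P$ satisfying: (a) every $T\in\mathcal{T}$ satisfies $|\widehat{T}|\le\frac{K}{n}\binom{n}{\lfloor n/2\rfloor}$; (b) for each $s$, the number of $T\in\mathcal{T}$ with $|\widehat{T}|=s$ is at most $\left(\frac{K\binom{n}{\lfloor n/2\rfloor}}{s}\right)^s\exp\left(\frac{K}{n}\binom{n}{\lfloor n/2\rfloor}\right)$; (c) $|C(g(I))|\le(k-1+\varepsilon)\binom{n}{\lfloor n/2\rfloor}$ for every independent set $I$ of $\mathcal{G}_P$.
   Context: $\mathcal{B}_n$ is the family of all subsets of $[n]$. A tree poset is a finite poset whose Hasse diagram is a tree; height is the largest number of elements in a chain. $\mathcal{G}_P$ is the $|P|$-uniform hypergraph on vertex set $\mathcal{B}_n$ whose edges are the $|P|$-element subfamilies inducing (under inclusion) a poset isomorphic to $P$; $\mathcal{I}(\mathcal{G}_P)$ is its set of independent sets. A fingerprint of $\mathcal{G}_P$ is a triple $(\mathcal{T},g,C)$ where: $\mathcal{T}$ is a collection of vectors $T=(T_1,\dots,T_m)$ of pairwise disjoint subsets of $\mathcal{B}_n$ (with $m$ allowed to vary), and $\widehat{T}=\bigcup_iT_i$; $g:\mathcal{I}(\mathcal{G}_P)\to\mathcal{T}$ satisfies $\widehat{g(I)}\subseteq I$ for every $I$; and $C:\mathcal{T}\to2^{\mathcal{B}_n}$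 satisfies $I\subseteq C(g(I))$ for every $I\in\mathcal{I}(\mathcal{G}_P)$. *)

(* Defs.v *)
From mathcomp Require Import all_boot all_order.
From Stdlib Require Import Reals.
Set Implicit Arguments. Unset Strict Implicit. Unset Printing Implicit Defensive.
Import Order.TTheory.
Local Open Scope order_scope.

Section PosetDefs.
Variables (d : Order.disp_t) (P : finPOrderType d).

Definition covers (x y : P) : bool :=
  (x < y) && [forall z : P, ~~ ((x < z) && (z < y))].

Definition hasse_adj : rel P := fun x y => covers x y || covers y x.

Definition hasse_connected : Prop := forall x y : P, connect hasse_adj x y.

Definition hasse_acyclic : Prop :=
  forall (x : P) (p : seq P),
    path hasse_adj x p -> uniq (x :: p) -> (2 <= size p)%N ->
    ~~ hasse_adj (last x p) x.

Definition tree_poset : Prop :=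
  (0 < #|P|)%N /\ hasse_connected /\ hasse_acyclic.

Definition is_chain (A : {set P}) : bool :=
  [forall x in A, forall y in A, (x <= y) || (y <= x)].

Definition height : nat := \max_(A : {set P} | is_chain A) #|A|.

(* F is an edge of G_P: a |P|-element subfamily of B_n inducing a copy of P *)
Definition induces_P (n : nat) (F : {set {set 'I_n}}) : Prop :=
  #|F| = #|P| /\
  exists f : P -> {set 'I_n},
    injective f /\ [set f x | x : P] = F /\
    forall x y : P, (x <= y) = (f x \subset f y).

Definition independent (n : nat) (I : {set {set 'I_n}}) : Prop :=
  forall F : {set {set 'I_n}}, F \subset I -> ~ induces_P F.

End PosetDefs.

Definition hatT (n : nat) (T : seq {set {set 'I_n}}) : {set {set 'I_n}} :=
  \bigcup_(A <- T) A.

Definition pairwise_disjoint_vec (n : nat) (T : seq {set {set 'I_n}}) : Prop :=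
  forall i j : nat, (i < j < size T)%N ->
    [disjoint nth set0 T i & nth set0 T j].

Definition fingerprint (d : Order.disp_t) (P : finPOrderType d) (n : nat)
  (calT : seq (seq {set {set 'I_n}}))
  (g : {set {set 'I_n}} -> seq {set {set 'I_n}})
  (C : seq {set {set 'I_n}} -> {set {set 'I_n}}) : Prop :=
  uniq calT /\
  (forall T, T \in calT -> pairwise_disjoint_vec T) /\
  (forall I : {set {set 'I_n}}, independent P I ->
     [/\ g I \in calT, hatT (g I) \subset I & I \subset C (g I)]).

(* Main.v *)
(* Let M be a uniformly random maximal chain of B_n and mu(x) = P(x in M), so that
   sizes are bounded by 'C(n, n/2) times the Lubell mass mu. Sets outside a narrow
   band of levels around n/2 are negligible and are put into every container.

   Supersaturation. If G lies in the band and mu(G) >= k - 1 + eps, the trace of M on G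
   contains in expectation at least eps windows of k consecutive members. Deleting
   pairs (position, vertex) carrying little window weight leaves position sets
   in which every vertex at position i sees, along M, many vertices at each other
   position j. Give the elements of P strictly increasing ranks and embed P greedily,
   leaf by leaf along its Hasse tree, with the transition weights of M: the new
   vertex avoids wrong comparabilities with the earlier ones except with small
   probability, the band being narrow. This gives a weight on the copies of P of
   total at least a constant. The transition kernels are reversible and bounded by
   tau ~ n^-r when comparable pairs of G differ by at least r levels, so the copies
   through a given set S of j vertices have weight at most tau^(j-1) min mu over S.

   Containers. A weighted form of the hypergraph container algorithm then finds,
   for every P-free I, a fingerprint in I of mass O(tau) determining a subset of G of
   constant mass that misses I. Iterate it: first with r = 5 on a residue class of levels,
   O(n) times, until the container has bounded mass, and then O(1) times with r = 1
   inside that container, where the number of fingerprints of size s is at most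
   (K 'C(n, n/2) / s)^s. *)

From mathcomp Require Import all_boot all_order all_algebra all_fingroup.
From mathcomp Require Import boolp Rstruct.
From mathcomp Require Import ring lra zify.
Require Import Defs.

Set Implicit Arguments. Unset Strict Implicit. Unset Printing Implicit Defensive.
Import Order.TTheory GRing.Theory Num.Theory.

(** * Tree posets *)

Section TreePoset.
Local Open Scope order_scope.
Variables (d : Order.disp_t) (P : finPOrderType d).
Implicit Types (u v p : P) (vs : seq P).

(** Why two regimes. One use of the container lemma removes only a bounded mass, while the whole
    cube has mass n + 1, so about n uses are made. With r = 1 each of them would cost about C/n
    sets, C being the middle binomial coefficient: n of them would cost about C, and the factor 2^m
    in the count of fingerprints, m being the number of parts, would be unbounded. A larger r makes
    tau so small that n fingerprints are cheap even when counted crudely, but pigeonholing over r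
    residues loses a factor r, so this regime stops at mass about r(k-1). The bounded number of
    steps with r = 1 then goes down to k-1+eps, with boundedly many parts. Why masses. The
    probability that a chain visits two vertices at a given distance in its trace is symmetric, so
    as a kernel it has row sums and column sums at most mu. Codegrees in a tree of such transitions
    are then controlled at every vertex, whatever its place in the tree and however irregular G
    is. *)

Definition rk v : nat :=
  \max_(A : {set P} | is_chain A && [forall x in A, x < v]) #|A|.

Lemma rk_witness v : exists2 A : {set P},
  is_chain A && [forall x in A, x < v] & #|A| = rk v.
Proof.
have h0 : is_chain (set0 : {set P}) && [forall x in (set0 : {set P}), x < v].
  by apply/andP; split; apply/forall_inP => x; rewrite in_set0.
have := @eq_bigmax_cond _ (fun A : {set P} => is_chain A && [forall x in A, x < v])
  (fun A : {set P} => #|A|).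
case=> [|A hA e]; last by exists A => //; rewrite /rk e.
by apply/card_gt0P; exists set0.
Qed.

Lemma chain_setU1 (A : {set P}) v :
  is_chain A -> [forall x in A, x < v] -> is_chain (v |: A).
Proof.
move=> /forall_inP cA /forall_inP lA.
apply/forall_inP => x /setU1P[->|xA]; apply/forall_inP => y /setU1P[->|yA].
- by rewrite lexx.
- by rewrite (ltW (lA _ yA)) orbT.
- by rewrite (ltW (lA _ xA)).
- by have /forall_inP := cA _ xA; apply.
Qed.

(** Adding [v] to a longest chain below it gives a longer chain. Ranks can therefore serve as
    positions in windows of [height P] consecutive members of a trace. *)
Lemma rk_lt_height v : (rk v < height P)%N.
Proof.
have [A /andP[cA lA] <-] := rk_witness v.
have -> : (#|A|.+1 = #|v |: A|)%N.
  rewrite cardsU1; case: (boolP (v \in A)) => // vA.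
  by have := forall_inP lA _ vA; rewrite ltxx.
by rewrite ?/height; apply: (bigop.bigmax_sup (v |: A)); rewrite ?chain_setU1.
Qed.

Lemma rk_mono u v : u < v -> (rk u < rk v)%N.
Proof.
move=> uv; have [A /andP[cA lA] <-] := rk_witness u.
have -> : (#|A|.+1 = #|u |: A|)%N.
  rewrite cardsU1; case: (boolP (u \in A)) => // vA.
  by have := forall_inP lA _ vA; rewrite ltxx.
rewrite ?/height; apply: (bigop.bigmax_sup (u |: A)) => //.
rewrite chain_setU1 //=; apply/forall_inP => x /setU1P[->//|xA].
exact: lt_trans (forall_inP lA _ xA) uv.
Qed.

Lemma hasse_adjC : symmetric (@hasse_adj d P).
Proof. by move=> x y; rewrite /hasse_adj orbC. Qed.

Lemma covers_lt u v : covers u v -> u < v.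
Proof. by case/andP. Qed.

Definition avoid v : rel P := fun x y => [&& hasse_adj x y, x != v & y != v].

Lemma avoidC v : symmetric (avoid v).
Proof. by move=> x y; rewrite /avoid hasse_adjC [X in _ && X]andbC. Qed.

Lemma path_avoid v x s : x != v -> path (avoid v) x s ->
  path (@hasse_adj d P) x s && (v \notin x :: s).
Proof.
elim: s x => [|y s IH] x xv /=; first by rewrite inE eq_sym xv.
case/andP=> /and3P[-> _ yv] /(IH _ yv) /andP[-> h] /=.
by rewrite inE negb_or eq_sym xv.
Qed.

(** A simple path from [x] to [y] avoiding [v] closes up through [v] to a cycle, unless it is
    trivial. Acyclicity enters only here. *)
Lemma acyclic_cut v x y : hasse_acyclic P ->
  hasse_adj v x -> hasse_adj v y -> x != v -> connect (avoid v) x y -> x = y.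
Proof.
move=> acy vx vy xv /connectP[s0 pth0 ey]; case/shortenP: pth0 ey => s pth us _ ey.
case/andP: (path_avoid xv pth) => pths vns.
case: s => [|z s] in pth us ey pths vns *; first by [].
have uv : uniq (v :: x :: z :: s) by rewrite cons_uniq vns us.
have pv : path (@hasse_adj d P) v (x :: z :: s) by rewrite /= vx.
by have := acy v _ pv uv isT; rewrite hasse_adjC /= -[last z s]/(last x (z :: s)) -ey vy.
Qed.

(** Induction on the size of the interval, split at an intermediate element. Staying inside the
    interval is what makes the walk avoid vertices outside it. *)
Lemma connect_up x y : x <= y ->
  connect (fun a b : P => [&& hasse_adj a b, x <= a <= y & x <= b <= y]) x y.
Proof.
set e := fun a b : P => _.
have [n] := ubnP #|[set z | x <= z <= y]|; elim: n x y @e => // n IH x y e hn xy.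
have [->|nxy] := eqVneq x y; first exact: connect0.
have ltxy : x < y by rewrite lt_neqAle nxy.
case: (boolP (covers x y)) => [cxy|]; last first.
  rewrite /covers ltxy /= negb_forall => /existsP[z]; rewrite negbK => /andP[xz zy].
  have mono a b a' b' : x <= a -> b <= y ->
      connect (fun s t : P => [&& hasse_adj s t, a <= s <= b & a <= t <= b]) a' b' ->
      connect e a' b'.
    move=> xa b_y; apply: connect_sub => s t /and3P[h /andP[h1 h2] /andP[h3 h4]].
    apply: connect1; rewrite /e h /= (le_trans xa h1) (le_trans xa h3) /=.
    by rewrite (le_trans h2 b_y) (le_trans h4 b_y).
  apply: (@connect_trans _ _ z).
    apply: (mono x z); rewrite ?(ltW zy) //; apply: IH (ltW xz).
    rewrite -ltnS; apply: leq_trans hn; rewrite ltnS; apply: proper_card.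
    apply/properP; split.
      by apply/subsetP => w; rewrite !inE => /andP[-> /le_trans]; apply; exact: ltW.
    by exists y; rewrite !inE ?lexx ?xy //= lt_geF ?andbF.
  apply: (mono z y); rewrite ?(ltW xz) //; apply: IH (ltW zy).
  rewrite -ltnS; apply: leq_trans hn; rewrite ltnS; apply: proper_card.
  apply/properP; split.
    by apply/subsetP => w; rewrite !inE => /andP[/(le_trans (ltW xz)) -> ->].
  by exists x; rewrite !inE ?lexx ?xy //= lt_geF.
by apply: connect1; rewrite /e /hasse_adj cxy !lexx xy.
Qed.

Lemma covered_below u v : u < v -> exists2 z, covers z v & u <= z.
Proof.
have [n] := ubnP #|[set z | u < z < v]|; elim: n u => // n IH u hn uv.
case: (boolP (covers u v)) => [cuv|]; first by exists u.
rewrite /covers uv /= negb_forall => /existsP[z]; rewrite negbK => /andP[uz zv].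
case: (IH z _ zv) => [|w cw zw]; last by exists w => //; apply: le_trans (ltW uz) zw.
rewrite -ltnS; apply: leq_trans hn; rewrite ltnS; apply: proper_card.
apply/properP; split.
  by apply/subsetP => w; rewrite !inE => /andP[/(lt_trans uz) -> ->].
by exists z; rewrite !inE ?ltxx ?uz.
Qed.

Lemma covered_above u v : u < v -> exists2 z, covers u z & z <= v.
Proof.
have [n] := ubnP #|[set z | u < z < v]|; elim: n v => // n IH v hn uv.
case: (boolP (covers u v)) => [cuv|]; first by exists v.
rewrite /covers uv /= negb_forall => /existsP[z]; rewrite negbK => /andP[uz zv].
case: (IH z _ uz) => [|w cw zw]; last by exists w => //; apply: le_trans zw (ltW zv).
rewrite -ltnS; apply: leq_trans hn; rewrite ltnS; apply: proper_card.
apply/properP; split.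
  by apply/subsetP => w; rewrite !inE => /andP[-> /lt_trans]; apply.
by exists z; rewrite !inE ?ltxx ?uz ?zv ?andbF.
Qed.

Definition par v vs : P := nth v vs (find (hasse_adj v) vs).

(* [vs] lists the vertices of a subtree, most recent first; each new vertex is
   a leaf, so its order relations are inherited from its unique neighbour. *)
Fixpoint leaf_order vs : Prop :=
  if vs is v :: vs' then
    vs' = [::] \/
    [/\ leaf_order vs', v \notin vs', has (hasse_adj v) vs' &
     let p := par v vs' in
     (p < v /\ forall u, u \in vs' -> (u <= v) = (u <= p) /\ (v <= u) = false) \/
     (v < p /\ forall u, u \in vs' -> (v <= u) = (p <= u) /\ (u <= v) = false)]
  else True.

Definition inside vs : rel P := fun x y => [&& hasse_adj x y, x \in vs & y \in vs].

(** If [u <= v], then [u] is below some lower cover [z] of [v], possibly outside [vs]. Both [p] and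
    [z] reach [u] without meeting [v], one inside [vs] and the other inside the interval from [u] to
    [z]; hence [z = p]. The other direction is dual. *)
Lemma leaf_relations vs v p : hasse_acyclic P ->
  {in vs &, forall x y, connect (inside vs) x y} ->
  v \notin vs -> p \in vs -> hasse_adj v p ->
  (p < v /\ forall u, u \in vs -> (u <= v) = (u <= p) /\ (v <= u) = false) \/
  (v < p /\ forall u, u \in vs -> (v <= u) = (p <= u) /\ (u <= v) = false).
Proof.
move=> acy con vn pvs adj.
have ne u : u \in vs -> u != v by apply: contraTneq => ->.
have conv x y : x \in vs -> y \in vs -> connect (avoid v) x y.
  move=> xv yv; apply: connect_sub (con _ _ xv yv) => s t /and3P[h hs ht].
  by apply: connect1; rewrite /avoid h !ne.
have up u : u \in vs -> u <= v -> p < v /\ u <= p.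
  move=> uvs uv; have ltuv : u < v by rewrite lt_neqAle ne.
  have [z cz uz] := covered_below ltuv.
  suff -> : p = z by split=> //; exact: covers_lt.
  apply: (acyclic_cut acy adj); [by rewrite /hasse_adj cz orbT | exact: ne |].
  apply: connect_trans (conv _ _ pvs uvs) _.
  apply: connect_sub (connect_up uz) => s t /and3P[h /andP[_ h1] /andP[_ h2]].
  apply: connect1; rewrite /avoid h /=.
  have nz w : w <= z -> w != v.
    by move=> wz; apply: contraTneq wz => ->; rewrite lt_geF // covers_lt.
  by rewrite !nz.
have down u : u \in vs -> v <= u -> v < p /\ p <= u.
  move=> uvs vu; have ltuv : v < u by rewrite lt_neqAle eq_sym ne.
  have [z cz uz] := covered_above ltuv.
  suff -> : p = z by split=> //; exact: covers_lt.
  apply: (acyclic_cut acy adj); [by rewrite /hasse_adj cz | exact: ne |].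
  apply: connect_trans (conv _ _ pvs uvs) _.
  rewrite (sym_connect_sym (avoidC v)).
  apply: connect_sub (connect_up uz) => s t /and3P[h /andP[h1 _] /andP[h2 _]].
  apply: connect1; rewrite /avoid h /=.
  have nz w : z <= w -> w != v.
    by move=> wz; apply: contraTneq wz => ->; rewrite lt_geF // covers_lt.
  by rewrite !nz.
case/orP: adj => /covers_lt lt; [right|left]; split=> // u uvs; split.
- apply/idP/idP => [/(down _ uvs)[]//|pu]; exact: le_trans (ltW lt) pu.
- by apply/negP => /(up _ uvs)[h _]; rewrite (lt_gtF lt) in h.
- apply/idP/idP => [/(up _ uvs)[]//|up']; exact: le_trans up' (ltW lt).
- by apply/negP => /(down _ uvs)[h _]; rewrite (lt_gtF lt) in h.
Qed.

(** A Hasse path from a listed vertex to an unlisted one leaves the list along some edge; the far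
    end of that edge is the next leaf. *)
Lemma exists_leaf_order : tree_poset P ->
  exists vs, [/\ leaf_order vs, uniq vs & forall v, v \in vs].
Proof.
case=> /card_gt0P[r0 _] [con acy].
suff H m : (0 < m <= #|P|)%N -> exists vs, [/\ leaf_order vs, uniq vs, size vs = m &
    {in vs &, forall x y, connect (inside vs) x y}].
  have [|vs [lo us sz _]] := H #|P|; first by rewrite leqnn (cardD1 r0).
  exists vs; split=> // v.
  apply: contraT => vn; have := max_card (mem (v :: vs)).
  by rewrite (card_uniqP _) ?cons_uniq ?vn //= sz ltnn.
elim: m => // m IH /andP[_ hm].
have [->|m0] := posnP m.
  exists [:: r0]; split=> //=; first by left.
  by move=> x y; rewrite !inE => /eqP-> /eqP->; exact: connect0.
have [|vs [lo us sz cvs]] := IH; first by rewrite m0 ltnW.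
have [v [vn hv]] : exists v, v \notin vs /\ has (hasse_adj v) vs.
  have [w wn] : exists w, w \notin vs.
    apply/existsP; rewrite -negb_forall; apply: contraL hm => /forallP h.
    by rewrite -leqNgt -sz cardE uniq_leq_size ?enum_uniq.
  have [x xvs] : exists x, x \in vs by case: (vs) sz m0 => [<-//|x l _ _]; exists x; rewrite mem_head.
  have /connectP[s pth ew] := con x w; rewrite {}ew in wn.
  elim: s x xvs pth wn => [|y s IHs] x xvs /=; first by rewrite xvs.
  case/andP=> axy pth wn; case: (boolP (y \in vs)) => yvs; first exact: IHs pth wn.
  by exists y; split=> //; apply/hasP; exists x; rewrite // hasse_adjC.
have pvs : par v vs \in vs by rewrite mem_nth // -has_find.
have adj : hasse_adj v (par v vs) by exact: nth_find.
exists (v :: vs); split.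
- by right; split=> //; exact: leaf_relations.
- by rewrite /= vn.
- by rewrite /= sz.
have sub x y : x \in vs -> y \in vs -> connect (inside (v :: vs)) x y.
  move=> xv yv; apply: connect_sub (cvs _ _ xv yv) => s t /and3P[h1 h2 h3].
  by apply: connect1; rewrite /inside h1 !inE h2 h3 !orbT.
have step : connect (inside (v :: vs)) v (par v vs) /\ connect (inside (v :: vs)) (par v vs) v.
  by split; apply: connect1; rewrite /inside ?[hasse_adj (par _ _) _]hasse_adjC adj !inE eqxx pvs ?orbT.
move=> x y; rewrite !inE => /predU1P[->|xv] /predU1P[->|yv].
- exact: connect0.
- exact: connect_trans step.1 (sub _ _ pvs yv).
- exact: connect_trans (sub _ _ xv pvs) step.2.
- exact: sub.
Qed.

End TreePoset.

(** * A weighted container lemma *)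

Section PartialSums.
Local Open Scope ring_scope.
Variables (R : realFieldType) (V : finType).
Implicit Types (W U G : seq V -> R) (os : seq (option V)) (xs : seq V).

(* [psum os W] sums the weight [W] over the lists of length [size os] that agree
   with the partial assignment [os]. *)
Fixpoint psum os W : R :=
  match os with
  | [::] => W [::]
  | Some x :: os' => psum os' (fun xs => W (x :: xs))
  | None :: os' => \sum_y psum os' (fun xs => W (y :: xs))
  end.

Definition tsum i W := psum (nseq i None) W.

Definition compat os xs :=
  all2 (fun o x => if o is Some z then x == z else true) os xs.

Lemma compat_size os xs : compat os xs -> size xs = size os.
Proof. by elim: os xs => [|o os IH] [|x xs] //= /andP[_ /IH ->]. Qed.

Lemma ler_psum os W W' :
  (forall xs, compat os xs -> W xs <= W' xs) -> psum os W <= psum os W'.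
Proof.
elim: os W W' => [|[x|] os IH] W W' h /=; first exact: h.
- by apply: IH => xs c; apply: h; rewrite /= eqxx.
- by apply: ler_sum => y _; apply: IH => xs c; apply: h.
Qed.

Lemma eq_psum os W W' :
  (forall xs, compat os xs -> W xs = W' xs) -> psum os W = psum os W'.
Proof. by move=> h; apply/le_anti/andP; split; apply: ler_psum => xs /h ->. Qed.

Lemma psum0 os : psum os (fun=> 0) = 0.
Proof. by elim: os => [|[x|] os IH] //=; apply: big1. Qed.

Lemma psum_ge0 os W : (forall xs, 0 <= W xs) -> 0 <= psum os W.
Proof. by move=> h; rewrite -(psum0 os); apply: ler_psum. Qed.

Lemma psumD os W W' : psum os (fun xs => W xs + W' xs) = psum os W + psum os W'.
Proof.
elim: os W W' => [|[x|] os IH] W W' //=.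
rewrite -big_split /=; apply: eq_bigr => y _.
exact: (IH (fun xs => W (y :: xs)) (fun xs => W' (y :: xs))).
Qed.

Lemma psumZ os a W : psum os (fun xs => a * W xs) = a * psum os W.
Proof.
elim: os W => [|[x|] os IH] W //=.
by rewrite mulr_sumr; apply: eq_bigr => y _; exact: (IH (fun xs => W (y :: xs))).
Qed.

Lemma psum_sum (J : finType) os (F : J -> seq V -> R) :
  psum os (fun xs => \sum_j F j xs) = \sum_j psum os (F j).
Proof.
elim: os F => [|[x|] os IH] F //=.
rewrite exchange_big /=; apply: eq_bigr => y _.
exact: (IH (fun j xs => F j (y :: xs))).
Qed.

Fixpoint omask (b : seq bool) xs : seq (option V) :=
  match b, xs with
  | c :: b', x :: xs' => (if c then Some x else None) :: omask b' xs'
  | _, _ => [::]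
  end.

Lemma omask_compat os xs : compat os xs -> omask (map isSome os) xs = os.
Proof.
elim: os xs => [|[z|] os IH] [|x xs] //=; last by move/IH->.
by case/andP=> /eqP-> /IH->.
Qed.

(** Both sums split over the values at the positions selected by [b]. Since [phi] sees only these,
    the hypothesis applies to one partial assignment at a time. *)
Lemma psum_omask (b : seq bool) (phi : seq (option V) -> bool) G U :
  (forall os, map isSome os = b -> phi os -> psum os G <= psum os U) ->
  tsum (size b) (fun xs => G xs * (phi (omask b xs))%:R) <=
  tsum (size b) (fun xs => U xs * (phi (omask b xs))%:R).
Proof.
rewrite /tsum; elim: b phi G U => [|[] b IH] phi G U h /=.
- by case: (boolP (phi [::])) => p; rewrite ?mulr1 ?mulr0 //; apply: (h [::]).
- apply: ler_sum => y _.
  apply: (IH (fun os => phi (Some y :: os)) (fun xs => G (y :: xs))).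
  by move=> os e; apply: (h (Some y :: os)); rewrite /= e.
- rewrite -!psum_sum.
  have e F : (fun xs => \sum_j F (j :: xs) * (phi (None :: omask b xs))%:R) =
       (fun xs => (\sum_j F (j :: xs)) * (phi (None :: omask b xs))%:R) :> (seq V -> R).
    by apply: funext => xs; rewrite mulr_suml.
  rewrite !e.
  apply: (IH (fun os => phi (None :: os)) (fun xs => \sum_j G (j :: xs))
             (fun xs => \sum_j U (j :: xs))).
  move=> os eos p; rewrite !psum_sum.
  by apply: (h (None :: os)); rewrite //= eos.
Qed.

End PartialSums.

Lemma ler_sum_subset (R : realFieldType) (V : finType) (mu : V -> R) (S S' : {set V}) :
  (forall x, 0 <= mu x)%R -> S \subset S' ->
  (\sum_(x in S) mu x <= \sum_(x in S') mu x)%R.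
Proof.
move=> mu0 sub; rewrite [leRHS](big_setID S) /= (setIidPr sub).
by rewrite lerDl sumr_ge0.
Qed.

(** * One pass of the container algorithm *)

Section Pass.
Local Open Scope ring_scope.
Variables (R : realFieldType) (V : finType) (mu : V -> R) (tau : R).
Implicit Types (W U G : seq V -> R) (os : seq (option V)) (xs : seq V).
Hypotheses (mu_ge0 : forall x, 0 <= mu x) (tau_gt0 : 0 < tau).

(** The codegree allowed to an assignment fixing [a]: each further fixed vertex costs a factor
    [tau]. It is used for assignments that contain [Some a], where the predecessor does not
    truncate. *)
Definition cap os a := mu a * tau ^+ (count isSome os).-1.

Definition spread B i W := forall os a, size os = i -> Some a \in os ->
  psum os W <= B * cap os a.

Definition saturated U os := exists2 a, Some a \in os & cap os a <= psum os U.

Definition sat U xs := `[< exists2 os, compat os xs & saturated U os >].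

Lemma cap_ge0 os a : 0 <= cap os a.
Proof. by rewrite mulr_ge0 // exprn_ge0 // ltW. Qed.

Lemma sat_mono U U' xs : (forall xs, U xs <= U' xs) -> sat U xs -> sat U' xs.
Proof.
move=> h /asboolP[os c [a aos le]]; apply/asboolP; exists os => //; exists a => //.
by apply: le_trans le _; apply: ler_psum.
Qed.

Variables (i : nat) (eta B : R) (W : seq V -> R).
Hypotheses (eta_gt0 : 0 < eta) (B_gt0 : 0 < B) (W_ge0 : forall xs, 0 <= W xs).
Hypothesis W_spread : spread B i.+1 W.

Definition link U y xs := W (y :: xs) * (~~ sat U xs)%:R.
Definition deg U y := tsum i (link U y).
Definition high U y := eta * mu y < deg U y.
(** The factor [tau^-1] compensates for dropping the fixed entry [y]: [cap (Some y :: os) a] is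
    [tau * cap os a]. *)
Definition transfer U y := fun xs => U xs + tau^-1 * link U y xs.

(* One pass of the container algorithm with oracle [A]: returns the weight
   passed on to lists shorter by one, the fingerprint and the discarded set. *)
Fixpoint pass (A : {set V}) vs U : (seq V -> R) * {set V} * {set V} :=
  if vs is y :: vs' then
    if high U y then
      if y \in A then
        let r := pass A vs' (transfer U y) in (r.1.1, y |: r.1.2, r.2)
      else let r := pass A vs' U in (r.1, y |: r.2)
    else pass A vs' U
  else (U, set0, set0).

Lemma link_ge0 U y xs : 0 <= link U y xs.
Proof. by rewrite mulr_ge0. Qed.

Lemma link_le U y xs : link U y xs <= W (y :: xs).
Proof. by rewrite /link; case: (sat _ _); rewrite /= ?mulr0 ?mulr1. Qed.

Lemma transfer_ge U y xs : U xs <= transfer U y xs.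
Proof. by rewrite lerDl mulr_ge0 ?link_ge0 // invr_ge0 ltW. Qed.

Lemma deg_le U y : deg U y <= B * mu y.
Proof.
have := W_spread (os := Some y :: nseq i None) (a := y).
rewrite /= size_nseq mem_head => /(_ erefl isT); rewrite /cap /= count_nseq mul0n mulr1.
by apply: le_trans; apply: ler_psum => xs _; exact: link_le.
Qed.

Lemma high_mu_gt0 U y : high U y -> 0 < mu y.
Proof.
move=> h; rewrite lt_neqAle mu_ge0 andbT; apply: contraTneq h => e.
by rewrite /high -e mulr0 -leNgt; apply: le_trans (deg_le _ _) _; rewrite -e mulr0.
Qed.

Lemma pass_T A vs U : forall x, x \in (pass A vs U).1.2 ->
  [/\ x \in A, x \in vs & 0 < mu x].
Proof.
elim: vs U => [|y vs IH] U x /=; first by rewrite inE.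
case: ifP => [hy|_]; last by move=> /IH[-> h ?]; rewrite inE h orbT.
case: ifP => [yA|_] /=; last by move=> /IH[-> h ?]; rewrite inE h orbT.
rewrite !inE => /predU1P[->|/IH[-> -> ?]]; last by rewrite orbT.
by rewrite eqxx yA; split=> //; exact: high_mu_gt0 hy.
Qed.

Lemma pass_D A vs U : forall x, x \in (pass A vs U).2 ->
  [/\ x \notin A, x \in vs & 0 < mu x].
Proof.
elim: vs U => [|y vs IH] U x /=; first by rewrite inE.
case: ifP => [hy|_]; last by move=> /IH[-> h ?]; rewrite inE h orbT.
case: ifP => [_|yA] /=; first by move=> /IH[-> h ?]; rewrite inE h orbT.
rewrite !inE => /predU1P[->|/IH[-> -> ?]]; last by rewrite orbT.
by rewrite eqxx yA; split=> //; exact: high_mu_gt0 hy.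
Qed.

(** The oracle is asked about high vertices only, and a positive answer enters the fingerprint.
    Taking the fingerprint itself for [A'] shows that it determines the whole run. *)
Lemma pass_oracle (A A' : {set V}) vs U : (pass A vs U).1.2 \subset A' -> A' \subset A ->
  pass A' vs U = pass A vs U.
Proof.
elim: vs U => [|y vs IH] U //= + sA.
case: ifP => [hy|_]; last by move=> h; apply: IH.
case: ifP => [yA|yA] /= h.
  move: h; rewrite subUset sub1set => /andP[-> h].
  by rewrite (IH _ h sA).
case: ifP => [yA'|_]; last by rewrite IH.
by rewrite (subsetP sA _ yA') in yA.
Qed.

Lemma pass_ge A vs U xs : U xs <= (pass A vs U).1.1 xs.
Proof.
elim: vs U => [|y vs IH] U //=.
by do 2?case: ifP => _ //=; apply: le_trans (IH _); exact: transfer_ge.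
Qed.

(** New weight on [xs] comes from some [y :: xs] with [y] in the fingerprint, hence in [A]. So if
    [A] contains no list in the support of [W], it contains none that receives new weight. *)
Lemma pass_supp A vs U xs : (pass A vs U).1.1 xs != 0 ->
  U xs != 0 \/ exists2 y, y \in (pass A vs U).1.2 & W (y :: xs) != 0.
Proof.
elim: vs U => [|y vs IH] U /=; first by left.
case: ifP => [hy|_]; last exact: IH.
case: ifP => [yA|_] /=; last exact: IH.
case/IH => [h|[z zT hz]]; last by right; exists z => //; rewrite !inE zT orbT.
have [e|nz] := eqVneq (W (y :: xs)) 0; last by right; exists y; rewrite ?setU11.
by left; move: h; rewrite /transfer /link e mul0r mulr0 addr0.
Qed.

(* Once [os] is saturated its weight is frozen; before that it is below [cap os a]
   and one transfer adds at most [B * cap os a]. *)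
Lemma psum_transfer U y os a : size os = i -> Some a \in os ->
  psum os U <= (1 + B) * cap os a -> psum os (transfer U y) <= (1 + B) * cap os a.
Proof.
move=> so aos h.
rewrite /transfer psumD psumZ.
have [le|lt] := leP (cap os a) (psum os U).
  rewrite (_ : psum os (link U y) = 0) ?mulr0 ?addr0 // -(psum0 R os).
  apply: eq_psum => xs c; rewrite /link (_ : sat U xs) ?mulr0 //.
  by apply/asboolP; exists os => //; exists a.
rewrite mulrDl mul1r lerD ?(ltW lt) // ler_pdivrMl //.
have := W_spread (os := Some y :: os) (a := a).
rewrite /= so inE aos orbT => /(_ erefl isT) le.
apply: le_trans (ler_psum _) (le_trans le _); first by move=> xs _; exact: link_le.
suff -> : cap (Some y :: os) a = tau * cap os a by rewrite mulrCA.
have : (0 < count isSome os)%N by rewrite -has_count; apply/hasP; exists (Some a).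
by rewrite /cap /=; case: (count _ _) => // q _; rewrite exprS mulrCA.
Qed.

Lemma pass_spread A vs U : spread (1 + B) i U -> spread (1 + B) i (pass A vs U).1.1.
Proof.
elim: vs U => [|y vs IH] U //= h.
do 2?case: ifP => _ /=; apply: IH => // os a so aos.
by apply: psum_transfer => //; exact: h.
Qed.

Lemma tsum_transfer U y : tau * tsum i (transfer U y) = tau * tsum i U + deg U y.
Proof.
rewrite /tsum /transfer psumD psumZ mulrDr mulVKf ?gt_eqF //.
Qed.

(** Each fingerprint vertex raises [tau * tsum i U] by its degree, which exceeds [eta * mu y]. Since
    the final weight is spread, this makes the fingerprint of mass O(tau). *)
Lemma pass_mass A vs U : uniq vs ->
  eta * \sum_(x in (pass A vs U).1.2) mu x + tau * tsum i U <=
  tau * tsum i (pass A vs U).1.1.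
Proof.
elim: vs U => [|y vs IH] U /=; first by rewrite big_set0 mulr0 add0r.
case/andP=> yvs uvs.
case: ifP => [hy|_]; last exact: IH.
case: ifP => [yA|_] /=; last exact: IH.
rewrite big_setU1 /=; last by apply/negP => /pass_T[_]; rewrite (negPf yvs).
apply: le_trans (IH _ uvs); rewrite tsum_transfer mulrDr.
move: hy; rewrite /high => /ltW; lra.
Qed.

(** Saturation is monotone, so the final degree of [y] is at most its degree when [y] was treated.
    That degree is paid by [eta * mu y] if [y] was not high, by the growth of [tau * tsum i U] if
    [y] entered the fingerprint, and by [B * mu y] if [y] was discarded. *)
Lemma pass_total A vs U : uniq vs ->
  \sum_(y <- vs) tsum i (link (pass A vs U).1.1 y) + tau * tsum i U <=
  eta * \sum_(y <- vs) mu y + B * \sum_(x in (pass A vs U).2) mu x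
  + tau * tsum i (pass A vs U).1.1.
Proof.
have lk U' U'' y : (forall xs, U' xs <= U'' xs) -> tsum i (link U'' y) <= deg U' y.
  move=> h; apply: ler_psum => xs _; rewrite ler_wpM2l // ler_nat.
  by case: (boolP (sat U' xs)) => [/(sat_mono h) ->|_] //; rewrite leq_b1.
elim: vs U => [|y vs IH] U /=; first by rewrite !big_nil big_set0 !mulr0 !add0r.
case/andP=> yvs uvs; rewrite !big_cons.
have le U' := lk U' _ y (pass_ge A vs U').
case: ifP => [hy|/negbT hy]; last first.
  rewrite /high -leNgt in hy; have := IH U uvs; have := le U; lra.
case: ifP => [yA|yA] /=.
  have := IH (transfer U y) uvs; rewrite tsum_transfer.
  have := lk U _ y (fun xs => le_trans (transfer_ge U y xs) (pass_ge A vs _ xs)).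
  have : 0 <= eta * mu y by rewrite mulr_ge0 // ltW.
  rewrite /deg; lra.
rewrite big_setU1 /=; last by apply/negP => /pass_D[_]; rewrite (negPf yvs).
have := IH U uvs; have := le_trans (le U) (deg_le U y).
have : 0 <= eta * mu y by rewrite mulr_ge0 // ltW.
lra.
Qed.

(** There are [2 ^+ i] patterns of fixed positions. Over a saturated assignment the weight [W], with
    free first entry, is at most [B * cap os a], hence at most [B] times the weight [U] there. *)
Lemma sat_total U : (forall xs, 0 <= U xs) ->
  \sum_y tsum i (fun xs => W (y :: xs) * (sat U xs)%:R) <=
  2 ^+ i * B * tsum i U.
Proof.
move=> U0; rewrite /tsum -psum_sum.
pose G xs := \sum_y W (y :: xs).
have G0 xs : 0 <= G xs by apply: sumr_ge0.
pose phi b xs := `[< saturated U (omask b xs) >].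
apply: (@le_trans _ _ (\sum_(b : i.-tuple bool)
    psum (nseq i None) (fun xs => G xs * (phi b xs)%:R))).
  rewrite -psum_sum; apply: ler_psum => xs c; rewrite -mulr_suml -mulr_sumr.
  apply: ler_wpM2l; first exact: G0.
  case: (boolP (sat U xs)) => [/asboolP[os cos so]|_] /=; last by apply: sumr_ge0.
  have sz : size (map isSome os) == i.
    by rewrite size_map -(compat_size cos) (compat_size c) size_nseq.
  rewrite (bigD1 (Tuple sz)) //=.
  have -> : phi (map isSome os) xs by apply/asboolP; rewrite omask_compat.
  by rewrite lerDl sumr_ge0.
apply: (@le_trans _ _ (\sum_(b : i.-tuple bool) B * psum (nseq i None) U)); last first.
  by rewrite sumr_const card_tuple card_bool -[leLHS]mulr_natl natrX mulrA.
apply: ler_sum => b _.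
apply: (@le_trans _ _ (psum (nseq i None) (fun xs => (B * U xs) * (phi b xs)%:R))); last first.
  rewrite -psumZ; apply: ler_psum => xs _; rewrite ler_piMr ?lern1 ?leq_b1 //.
  by rewrite mulr_ge0 // ltW.
have := @psum_omask R V b (fun os => `[< saturated U os >]) G (fun xs => B * U xs).
rewrite /tsum size_tuple; apply => os e /asboolP[a aos le].
rewrite psumZ /G psum_sum.
have := W_spread (os := None :: os) (a := a).
rewrite /= inE aos orbT -(size_map isSome) e size_tuple => /(_ erefl isT) h.
by apply: le_trans h _; rewrite ler_pM2l.
Qed.

(** [W] is split according to whether the tail of the list ends up saturated. This yields the
    dichotomy behind the recursion: either the discarded set or the weight passed on is large. *)
Lemma pass_lower A r : tau <= 1 -> r = pass A (enum V) (fun=> 0) ->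
  tsum i.+1 W <= eta * \sum_x mu x + B * \sum_(x in r.2) mu x
                 + (1 + 2 ^+ i * B) * tsum i r.1.1.
Proof.
move=> tau1 er; have r0 xs : 0 <= r.1.1 xs by rewrite er; apply: (pass_ge _ _ (fun=> 0)).
have := pass_total A (fun=> 0) (enum_uniq V); rewrite -er !big_enum /=.
rewrite [tsum i (fun=> 0)]psum0 mulr0 addr0 => h1.
have h2 := sat_total r0.
have h3 : tau * tsum i r.1.1 <= tsum i r.1.1 by rewrite ler_piMl ?psum_ge0.
have -> : tsum i.+1 W = \sum_y tsum i (link r.1.1 y) +
    \sum_y tsum i (fun xs => W (y :: xs) * (sat r.1.1 xs)%:R).
  rewrite -big_split /=; apply: eq_bigr => y _; rewrite /tsum -psumD.
  apply: eq_psum => xs _; rewrite /link; case: (sat _ _); rewrite /= ?mulr0 ?mulr1; lra.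
lra.
Qed.

End Pass.

(** * Recursion on the length of the lists *)

Section Container.
Local Open Scope ring_scope.
Variable R : realFieldType.

(* [Tf I] is the fingerprint of [I] and [Df I] a set of vertices outside [I]
   that depends on [I] only through [Tf I]. *)
Lemma container_step i (B zeta m : R) : 0 < B -> 0 < zeta -> 0 < m ->
  exists c K : R, [/\ 0 < c, 0 < K &
  forall (V : finType) (mu : V -> R) (tau : R) (W : seq V -> R),
    0 < tau -> tau <= 1 -> (forall x, 0 <= mu x) -> \sum_x mu x <= m ->
    (forall xs, 0 <= W xs) -> spread mu tau B i.+1 W ->
  exists (Tf : {set V} -> seq {set V}) (Df : {set V} -> {set V}), forall I : {set V},
  [/\ size (Tf I) = i /\ (forall T, T \in Tf I ->
         (forall x, x \in T -> x \in I /\ 0 < mu x) /\ \sum_(x in T) mu x <= K * tau),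
     forall x, x \in Df I -> 0 < mu x,
     (forall xs, size xs = i.+1 -> W xs != 0 -> exists2 x, x \in xs & x \notin I) ->
       forall x, x \in Df I -> x \notin I,
     forall I', Tf I = Tf I' -> Df I = Df I' &
     zeta <= tsum i.+1 W -> c <= \sum_(x in Df I) mu x]].
Proof.
elim: i B zeta => [|i IH] B zeta B0 z0 m0.
  (* For lists of length one no fingerprint is required: an independent set misses every vertex of
     positive weight. *)
  exists (zeta / B), 1; split; rewrite ?divr_gt0 // => V mu tau W t0 t1 mu0 smu W0 Wsp.
  have Wle x : W [:: x] <= B * mu x.
    have := Wsp [:: Some x] x erefl; rewrite mem_head => /(_ isT).
    by rewrite /cap /= expr0 mulr1.
  exists (fun=> [::]), (fun=> [set x | 0 < W [:: x]]) => I; split=> //.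
  - move=> x; rewrite inE => h.
    by have := lt_le_trans h (Wle x); rewrite pmulr_rgt0.
  - move=> ind x; rewrite inE => h.
    by have [|y] := ind [:: x] erefl; [rewrite gt_eqF | rewrite inE => /eqP->].
  - move=> h; rewrite ler_pdivrMr // (le_trans h) // mulr_suml.
    rewrite /tsum /= [leLHS](bigID (fun x => 0 < W [:: x])) /= [X in _ + X]big1 ?addr0.
      rewrite (eq_bigl (fun x => x \in [set x | 0 < W [:: x]])) => [|x]; last by rewrite inE.
      by apply: ler_sum => x _; rewrite mulrC.
    by move=> x; rewrite -leNgt => h'; apply/le_anti; rewrite h' W0.
(* Two of the three terms of [pass_lower] become at most [zeta / 4] when the discarded mass is below
   [c1]; the weight passed on then has total at least [zeta / (2 * A)]. *)
pose eta := zeta / (4 * m); pose c1 := zeta / (4 * B).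
have e0 : 0 < eta by rewrite divr_gt0 ?mulr_gt0.
have c10 : 0 < c1 by rewrite divr_gt0 ?mulr_gt0.
pose A := 1 + 2 ^+ i.+1 * B.
have A0 : 0 < A by rewrite ltr_wpDl // mulr_gt0 ?exprn_gt0.
have B1 : 0 < 1 + B by rewrite addr_gt0.
have z1 : 0 < zeta / (2 * A) by rewrite divr_gt0 ?mulr_gt0.
have [c [K [c0 K0 H]]] := IH (1 + B) (zeta / (2 * A)) B1 z1 m0.
exists (Num.min c c1), (Num.max K ((1 + B) * m / eta)).
split; rewrite ?lt_min ?lt_max ?c0 ?K0 // => V mu tau W t0 t1 mu0 smu W0 Wsp.
pose ps J := pass mu tau i.+1 eta W J (enum V) (fun=> 0).
have U0 J xs : 0 <= (ps J).1.1 xs by exact: (pass_ge mu t0 i.+1 eta W0 J (enum V) (fun=> 0)).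
have sp0 : spread mu tau (1 + B) i.+1 (fun=> 0).
  by move=> os a _ _; rewrite psum0 mulr_ge0 ?cap_ge0 // ltW.
have Usp J : spread mu tau (1 + B) i.+1 (ps J).1.1.
  exact: (pass_spread t0 eta W0 Wsp J (enum V) sp0).
(* The weight passed on depends on [I]. Choosing one answer for each weight makes the recursive call
   a function of that weight, hence of the fingerprint. *)
have H' (U : seq V -> R) : exists TD : ({set V} -> seq {set V}) * ({set V} -> {set V}),
    (forall xs, 0 <= U xs) -> spread mu tau (1 + B) i.+1 U ->
    forall I : {set V}, [/\ size (TD.1 I) = i /\ (forall T, T \in TD.1 I ->
         (forall x, x \in T -> x \in I /\ 0 < mu x) /\ \sum_(x in T) mu x <= K * tau),
     forall x, x \in TD.2 I -> 0 < mu x,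
     (forall xs, size xs = i.+1 -> U xs != 0 -> exists2 x, x \in xs & x \notin I) ->
       forall x, x \in TD.2 I -> x \notin I,
     forall I', TD.1 I = TD.1 I' -> TD.2 I = TD.2 I' &
     zeta / (2 * A) <= tsum i.+1 U -> c <= \sum_(x in TD.2 I) mu x].
  have [[h1 h2]|h] := pselect ((forall xs, 0 <= U xs) /\ spread mu tau (1 + B) i.+1 U).
    by have [Tf [Df h]] := H V mu tau U t0 t1 mu0 smu h1 h2; exists (Tf, Df).
  by exists (fun=> [::], fun=> set0) => h1 h2; case: h.
have [TD HTD] := choice H'.
exists (fun I => (ps I).1.2 :: (TD (ps I).1.1).1 I), (fun I => (ps I).2 :|: (TD (ps I).1.1).2 I).
move=> I; have [[hs hT] hmu hind hdet hlow] := HTD _ (U0 I) (Usp I) I.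
have sK : K <= Num.max K ((1 + B) * m / eta) by rewrite le_max lexx.
split.
- split; first by rewrite /= hs.
  move=> T; rewrite inE => /predU1P[->|/hT[h1 h2]]; last first.
    by split=> //; apply: le_trans h2 _; rewrite ler_pM2r.
  split=> [x /(pass_T mu0 W0 Wsp)[]//|].
  have := pass_mass mu0 t0 eta W0 Wsp I (fun=> 0) (enum_uniq V).
  rewrite [tsum _ (fun=> 0)]psum0 mulr0 addr0 -/(ps I) => h.
  have hU : tsum i.+1 (ps I).1.1 <= (1 + B) * m.
    apply: (@le_trans _ _ (\sum_x (1 + B) * mu x)); last by rewrite -mulr_sumr ler_pM2l.
    apply: ler_sum => x _; have := Usp I (Some x :: nseq i None) x.
    rewrite /= size_nseq mem_head => /(_ erefl isT).
    by rewrite /cap /= count_nseq mul0n mulr1.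
  apply: (@le_trans _ _ ((1 + B) * m / eta * tau)).
    rewrite -mulrA [eta^-1 * _]mulrC mulrA ler_pdivlMr // mulrC (le_trans h) //.
    by rewrite mulrC ler_pM2r.
  by rewrite ler_pM2r // le_max lexx orbT.
- by move=> x; rewrite inE => /orP[/(pass_D mu0 W0 Wsp)[]//|/hmu].
- move=> ind x; rewrite inE => /orP[/(pass_D mu0 W0 Wsp)[]//|]; apply: hind => xs sxs nz.
  case: (pass_supp nz) => [|[y yT hy]]; first by rewrite eqxx.
  have [|z] := ind (y :: xs) _ hy; first by rewrite /= sxs.
  have [yI _ _] := pass_T mu0 W0 Wsp yT.
  by rewrite inE => /predU1P[->|zxs zI]; [rewrite yI | exists z].
- move=> I' [eT eTs].
  have sub J : (ps J).1.2 \subset J by apply/subsetP => x /(pass_T mu0 W0 Wsp)[].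
  have e : ps I = ps I'.
    rewrite /ps -(pass_oracle (subxx _) (sub I)) -(pass_oracle (subxx _) (sub I')).
    by rewrite -!/(ps _) eT.
  by rewrite -e in eTs *; rewrite (hdet I').
- move=> hz.
  have [hc|hc] := leP c1 (\sum_(x in (ps I).2) mu x).
    apply: le_trans (_ : c1 <= _); first by rewrite ge_min lexx orbT.
    by apply: le_trans hc _; apply: ler_sum_subset; rewrite ?subsetUl.
  apply: (@le_trans _ _ c); first by rewrite ge_min lexx.
  apply: (@le_trans _ _ (\sum_(x in (TD (ps I).1.1).2 I) mu x)).
    apply: hlow; rewrite ler_pdivrMr ?mulr_gt0 //.
    have := pass_lower mu0 t0 e0 B0 W0 Wsp (A := I) t1 (erefl _); rewrite -/(ps I) -/A.
    have h1 : eta * \sum_x mu x <= zeta / 4.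
      apply: (@le_trans _ _ (eta * m)); first by rewrite ler_pM2l.
      by rewrite (_ : eta * m = zeta / 4) // /eta; field; rewrite gt_eqF.
    have h2 : B * (\sum_(x in (ps I).2) mu x) <= zeta / 4.
      apply: (@le_trans _ _ (B * c1)); first by rewrite ler_pM2l // ltW.
      by rewrite (_ : B * c1 = zeta / 4) // /c1; field; rewrite gt_eqF.
    lra.
  by apply: ler_sum_subset; rewrite ?subsetUr.
Qed.

End Container.

(** * Weights spread along a tree *)

Section TreeWeight.
Local Open Scope ring_scope.
Variables (R : realFieldType) (V : finType) (mu : V -> R) (tau : R).
Implicit Types (W : seq V -> R) (os : seq (option V)) (xs : seq V) (q : V -> V -> R).
Hypotheses (mu_ge0 : forall x, 0 <= mu x) (tau_gt0 : 0 < tau).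

(** A joint law with both marginals at most [mu]; dividing by [mu z] gives transition probabilities.
    The column sums serve to reach a free parent from a fixed leaf. *)
Definition kernel q :=
  [/\ forall z x, 0 <= q z x, forall z, \sum_x q z x <= mu z,
      forall x, \sum_z q z x <= mu x, forall z x, q z x <= tau * mu z &
      forall z x, q z x <= tau * mu x].

(* An entry [(i, q)] attaches the new vertex [x] with kernel [q] to the vertex at
   position [i] of the list of the earlier ones. *)
Fixpoint tree_weight (ks : seq (nat * (V -> V -> R))) xs : R :=
  match ks, xs with
  | [::], x :: _ => mu x
  | (i, q) :: ks', x :: xs' =>
      tree_weight ks' xs' * (q (nth x xs' i) x / mu (nth x xs' i))
  | _, _ => 0
  end.

Fixpoint kernels (ks : seq (nat * (V -> V -> R))) : Prop :=
  if ks is (i, q) :: ks' then [/\ (i <= size ks')%N, kernel q & kernels ks'] else True.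

Lemma psum_set_nth os i W : (i < size os)%N -> nth None os i = None ->
  psum os W = \sum_z psum (set_nth None os i (Some z)) W.
Proof.
elim: os i W => [|[x|] os IH] [|i] W //= hi hn; first exact: IH.
rewrite exchange_big /=; apply: eq_bigr => y _; exact: IH.
Qed.

Lemma compat_nth os xs i z x : compat os xs -> nth None os i = Some z -> nth x xs i = z.
Proof.
elim: os xs i => [|o os IH] [|y xs] [|i] //= /andP[h c] e; last exact: IH c e.
by rewrite e in h; exact/eqP.
Qed.

Lemma count_set_nth os i z : (i < size os)%N -> nth None os i = None ->
  count isSome (set_nth None os i (Some z)) = (count isSome os).+1.
Proof.
elim: os i => [|o os IH] [|i] //= hi e; first by rewrite e.
by rewrite IH // addnS.
Qed.

Lemma tree_weight_ge0 ks xs : kernels ks -> 0 <= tree_weight ks xs.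
Proof.
elim: ks xs => [|[i q] ks IH] [|x xs] //= [_ [q0 _ _ _ _] ok].
by rewrite mulr_ge0 ?IH // divr_ge0.
Qed.

Lemma ratio_le1 (s m : R) : 0 <= m -> s <= m -> s / m <= 1.
Proof.
rewrite le_eqVlt => /predU1P[<-|m0] h; first by rewrite invr0 mulr0.
by rewrite ler_pdivrMr // mul1r.
Qed.

Lemma ratioK (s m : R) : 0 <= s -> s <= m -> s / m * m = s.
Proof.
move=> s0 sm; have [e|nz] := eqVneq m 0; last by rewrite divfK.
by apply/eqP; rewrite e mulr0 eq_le s0 -e sm.
Qed.

(** Remove the last leaf. A free leaf has transition mass at most 1, and a leaf fixed besides [a]
    costs a factor [tau]. If [a] is the leaf and occurs nowhere else, induction is applied at the
    parent [z]: a fixed [z] is handled by [q z x <= tau * mu x], a free one is filled in and summed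
    out by column sums. *)
Lemma tree_weight_spread ks : kernels ks ->
  spread mu tau 1 (size ks).+1 (tree_weight ks).
Proof.
elim: ks => [_|[i q] ks IH] /=.
  move=> [|o [|o' os]] a //= _; rewrite inE => /eqP <-.
  by rewrite mul1r /cap /= mulr1.
case=> hi [q0 qs1 qs2 qt1 qt2] ok.
have {}IH := IH ok.
have w0 z x : 0 <= q z x / mu z by rewrite divr_ge0.
have qmu z x : q z x <= mu z.
  by apply: le_trans (qs1 z); rewrite (bigD1 x) //= lerDl sumr_ge0.
have wt z x : q z x / mu z <= tau.
  have [e|nz] := eqVneq (mu z) 0; first by rewrite e invr0 mulr0 ltW.
  by rewrite ler_pdivrMr // lt_neqAle eq_sym nz mu_ge0.
move=> [|[y|] os] a //= [so]; rewrite mul1r.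
  have [aos|aos] := boolP (Some a \in os).
    move=> _; have cnt : (0 < count isSome os)%N.
      by rewrite -has_count; apply/hasP; exists (Some a).
    apply: (@le_trans _ _ (tau * psum os (tree_weight ks))).
      rewrite -psumZ; apply: ler_psum => xs _; rewrite mulrC.
      by rewrite ler_wpM2r ?wt ?tree_weight_ge0.
    apply: (@le_trans _ _ (tau * cap mu tau os a)).
      by rewrite ler_pM2l // -[leRHS]mul1r; apply: IH.
    by rewrite /cap /= mulrCA; case: (count _ _) cnt => // k _; rewrite /= exprS.
  rewrite inE (negPf aos) orbF => /eqP[->]; rewrite /cap /=.
  have io : (i < size os)%N by rewrite so ltnS.
  case e: (nth None os i) => [z|].
    have zos : Some z \in os by rewrite -e mem_nth.
    have cnt : (0 < count isSome os)%N.
      by rewrite -has_count; apply/hasP; exists (Some z).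
    rewrite (eq_psum (W' := fun xs => q z y / mu z * tree_weight ks xs)); last first.
      by move=> xs c; rewrite (compat_nth y c e) mulrC.
    rewrite psumZ; apply: (@le_trans _ _ (q z y / mu z * cap mu tau os z)).
      by apply: ler_wpM2l => //; rewrite -[leRHS]mul1r; apply: IH.
    rewrite /cap mulrA ratioK //.
    case: (count _ _) cnt => // k _; rewrite /= exprS mulrA [_ * tau]mulrC.
    by rewrite ler_wpM2r // exprn_ge0 // ltW.
  rewrite (psum_set_nth _ io e).
  apply: (@le_trans _ _ (\sum_z q z y * tau ^+ count isSome os)); last first.
    by rewrite -mulr_suml ler_wpM2r // exprn_ge0 // ltW.
  apply: ler_sum => z _; set os' := set_nth _ _ _ _.
  have e' : nth None os' i = Some z by rewrite nth_set_nth /= eqxx.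
  rewrite (eq_psum (W' := fun xs => q z y / mu z * tree_weight ks xs)); last first.
    by move=> xs c; rewrite (compat_nth y c e') mulrC.
  have so' : size os' = (size ks).+1.
    by rewrite size_set_nth so; apply/maxn_idPr; rewrite ltnS.
  rewrite psumZ; apply: (@le_trans _ _ (q z y / mu z * cap mu tau os' z)).
    apply: ler_wpM2l => //; rewrite -[leRHS]mul1r; apply: IH => //.
    by rewrite -e' mem_nth // so' ltnS.
  by rewrite /cap count_set_nth //= mulrA ratioK.
rewrite inE /= => aos.
have -> : cap mu tau (None :: os) a = 1 * cap mu tau os a by rewrite mul1r.
apply: le_trans (IH os a so aos).
rewrite -psum_sum; apply: ler_psum => xs /compat_size sxs; rewrite -mulr_sumr ler_piMr ?tree_weight_ge0 //.
have si : (i < size xs)%N by rewrite sxs so ltnS.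
case: xs si {sxs} => // x0 xs si.
rewrite (eq_bigr (fun x => q (nth x0 (x0 :: xs) i) x / mu (nth x0 (x0 :: xs) i))).
  by rewrite -mulr_suml ratio_le1.
by move=> x _; rewrite (set_nth_default x0).
Qed.

End TreeWeight.

(** * Random maximal chains *)

Section RandomChain.
Local Open Scope ring_scope.
Variables (R : realFieldType) (n : nat).
Local Notation V := {set 'I_n}.
Implicit Types (s : {perm 'I_n}) (x y z w : V) (G : {set V}).

Lemma sum_indicator (T : finType) (p : pred T) :
  \sum_i (p i)%:R = #|p|%:R :> R.
Proof. by rewrite -natr_sum -sum1_card [in RHS]big_mkcond /=; congr (_%:R); apply: eq_bigr => i _; rewrite unfold_in; case: (p i). Qed.

Lemma card_indicator (T : finType) (A : {pred T}) : #|A|%:R = \sum_i (i \in A)%:R :> R.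
Proof. by rewrite sum_indicator. Qed.

Lemma sum_indicator_le1 (T : finType) (p : pred T) :
  (forall i j, p i -> p j -> i = j) -> \sum_i (p i)%:R <= 1 :> R.
Proof.
move=> h; rewrite sum_indicator lern1; apply/card_le1_eqP => i j pi pj; exact: h.
Qed.

Definition Ex (f : {perm 'I_n} -> R) : R := #|{perm 'I_n}|%:R^-1 * \sum_s f s.

Lemma card_perm_gt0 : 0 < #|{perm 'I_n}|%:R :> R.
Proof. by rewrite ltr0n; apply/card_gt0P; exists 1%g. Qed.

Lemma ler_Ex f g : (forall s, f s <= g s) -> Ex f <= Ex g.
Proof.
move=> h; rewrite ler_pM2l ?invr_gt0 ?card_perm_gt0 //; exact: ler_sum.
Qed.

Lemma eq_Ex f g : f =1 g -> Ex f = Ex g.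
Proof. by move=> h; congr (_ * _); apply: eq_bigr. Qed.

Lemma ExD f g : Ex (fun s => f s + g s) = Ex f + Ex g.
Proof. by rewrite /Ex big_split mulrDr. Qed.

Lemma ExB f g : Ex (fun s => f s - g s) = Ex f - Ex g.
Proof. by rewrite /Ex sumrB mulrBr. Qed.

Lemma ExZ a f : Ex (fun s => a * f s) = a * Ex f.
Proof. by rewrite /Ex -mulr_sumr mulrCA. Qed.

Lemma Ex_sum (T : finType) (p : pred T) F :
  Ex (fun s => \sum_(t | p t) F t s) = \sum_(t | p t) Ex (F t).
Proof. by rewrite /Ex exchange_big mulr_sumr. Qed.

Lemma Ex_const a : Ex (fun=> a) = a.
Proof. by rewrite /Ex sumr_const -[X in _ * X]mulr_natl mulKf // gt_eqF // card_perm_gt0. Qed.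

Lemma Ex_ge0 f : (forall s, 0 <= f s) -> 0 <= Ex f.
Proof. by move=> h; rewrite -(Ex_const 0); exact: ler_Ex. Qed.

Lemma Ex_mul f (t : {perm 'I_n}) : Ex (fun s => f (s * t)%g) = Ex f.
Proof.
by rewrite /Ex; congr (_ * _); rewrite [RHS](reindex_inj (mulIg t)).
Qed.

(* [pre s j] is the level-[j] member of the maximal chain defined by [s]. *)
Definition pre s j : V := [set s i | i : 'I_n & (i < j)%N].
Definition onc s x := pre s #|x| == x.

Lemma card_pre s j : (j <= n)%N -> #|pre s j| = j.
Proof.
move=> jn; rewrite card_imset; last exact: perm_inj.
transitivity #|[set widen_ord jn i | i : 'I_j]|.
  apply: eq_card => i; rewrite inE; apply/idP/imsetP => [ij|[k _ ->]]; last exact: (ltn_ord k).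
  by exists (Ordinal ij) => //; exact: val_inj.
by rewrite card_imset ?card_ord // => a b /(congr1 val) /= e; exact: val_inj.
Qed.

Lemma pre_mono s i j : (i <= j)%N -> pre s i \subset pre s j.
Proof.
move=> ij; apply/subsetP => e /imsetP[k ki ->]; apply: imset_f.
by move: ki; rewrite !inE => ki; apply: leq_trans ki ij.
Qed.

Lemma onc_pre s j : (j <= n)%N -> onc s (pre s j).
Proof. by move=> jn; rewrite /onc card_pre. Qed.

Lemma card_leq_n x : (#|x| <= n)%N.
Proof. by have := max_card (mem x); rewrite card_ord. Qed.

Lemma onc_sub s x y : onc s x -> onc s y -> (#|x| <= #|y|)%N -> x \subset y.
Proof. by move=> /eqP <- /eqP <- h; apply: pre_mono; move: h; rewrite !card_pre ?card_leq_n. Qed.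

Lemma onc_inj s x y : onc s x -> onc s y -> #|x| = #|y| -> x = y.
Proof. by move=> /eqP <- /eqP <-; rewrite !card_pre ?card_leq_n // => ->. Qed.

Lemma pre_mul s (t : {perm 'I_n}) j : pre (s * t)%g j = t @: pre s j.
Proof. by rewrite /pre -imset_comp; apply: eq_imset => i /=; rewrite permM. Qed.

Lemma onc_mul s (t : {perm 'I_n}) x : onc (s * t)%g (t @: x) = onc s x.
Proof.
rewrite /onc card_imset; last exact: perm_inj.
by rewrite pre_mul (inj_eq (imset_inj (@perm_inj _ t))).
Qed.

Lemma tperm_out (e e' : 'I_n) x : e \notin x -> e' \notin x -> tperm e e' @: x = x.
Proof.
move=> ex ex'; rewrite -[RHS]imset_id; apply: eq_in_imset => i ix.
by rewrite tpermD //; [apply: contraNneq ex | apply: contraNneq ex'] => ->.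
Qed.

Lemma tperm_in (e e' : 'I_n) x : e \in x -> e' \in x -> tperm e e' @: x = x.
Proof.
move=> ex ex'; apply/eqP; rewrite eqEcard card_imset ?leqnn ?andbT; last exact: perm_inj.
by apply/subsetP => i /imsetP[j jx ->]; case: tpermP => // ->.
Qed.

(** Exchanging an element of [y :\: y'] with one of [y' :\: y] preserves [Phi] and brings [y] closer
    to [y']. *)
Lemma swap_invariant (Phi : V -> R) (Q : V) :
  (forall y e e', e \in Q -> e' \in Q -> Phi (tperm e e' @: y) = Phi y) ->
  forall y y', #|y| = #|y'| -> y :\: y' \subset Q -> y' :\: y \subset Q -> Phi y = Phi y'.
Proof.
move=> inv y y'; have [m] := ubnP #|y :\: y'|; elim: m y => // m IH y hm cy s1 s2.
have cd : #|y :\: y'| = #|y' :\: y| by rewrite !cardsD setIC cy.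
have [/eqP|] := posnP #|y :\: y'|.
  rewrite cards_eq0 setD_eq0 => sub; congr Phi; apply/eqP.
  by rewrite eqEcard sub cy /=.
move=> pos; have /card_gt0P[e' he'] : (0 < #|y' :\: y|)%N by rewrite -cd.
move/card_gt0P: pos => [e he].
have eQ := subsetP s1 _ he; have e'Q := subsetP s2 _ he'.
rewrite -(inv y e e' eQ e'Q).
move: (he) (he'); rewrite !inE => /andP[ey' ey] /andP[e'y e'y'].
have memt i : (i \in tperm e e' @: y) = (i == e') || (i != e) && (i \in y).
  rewrite -{1}(tpermK e e' i) mem_imset; last exact: perm_inj.
  case: tpermP => [->|->|/eqP ne /eqP ne'].
  - by rewrite eqxx (negPf e'y) /=; case: eqP => // ee; rewrite -ee ey in e'y.
  - by rewrite eqxx ey.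
  - by rewrite (negPf ne') ne.
apply: IH.
- rewrite -ltnS; apply: leq_trans hm; rewrite ltnS; apply: proper_card; apply/properP.
  split.
    apply/subsetP => i; rewrite !inE memt => /andP[iy' /orP[/eqP ei|/andP[_ ->]]].
      by rewrite ei e'y' in iy'.
    by rewrite iy'.
  by exists e => //; rewrite inE memt ey' eqxx /= orbF; apply: contraNneq ey' => ->.
- by rewrite card_imset //; exact: perm_inj.
- apply/subsetP => i; rewrite !inE memt => /andP[iy' /orP[/eqP ->//|/andP[_ iy]]].
  by apply: (subsetP s1); rewrite inE iy' iy.
- apply/subsetP => i; rewrite !inE memt negb_or negb_and negbK => /andP[/andP[ie' /orP[/eqP->|iy]] iy'] //.
  by apply: (subsetP s2); rewrite inE iy iy'.
Qed.

Definition lub x := Ex (fun s => (onc s x)%:R).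
Definition lub2 x y := Ex (fun s => (onc s x && onc s y)%:R).

Lemma lub_ge0 x : 0 <= lub x. Proof. by apply: Ex_ge0. Qed.

Lemma lub_le1 x : lub x <= 1.
Proof. by rewrite -(Ex_const 1); apply: ler_Ex => s; rewrite lern1 leq_b1. Qed.

Lemma lub2_mul (t : {perm 'I_n}) x y : lub2 (t @: x) (t @: y) = lub2 x y.
Proof. by rewrite -[LHS](Ex_mul _ t); apply: eq_Ex => s; rewrite !onc_mul. Qed.

Lemma lubE x : lub x * 'C(n, #|x|)%:R = 1.
Proof.
have -> : 'C(n, #|x|) = #|[set y : V | y \subset setT & #|y| == #|x|]|.
  by rewrite cards_draws cardsT card_ord.
rewrite mulrC mulr_natl -sumr_const.
transitivity (\sum_(y in [set y : V | y \subset setT & #|y| == #|x|]) lub y).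
  apply: eq_bigr => y; rewrite inE => /andP[_ /eqP cy].
  apply: (@swap_invariant lub setT) => [z e e' _ _|||]; rewrite ?subsetT ?cy //.
  by rewrite /lub -[LHS](Ex_mul _ (tperm e e')); apply: eq_Ex => s; rewrite onc_mul.
rewrite -Ex_sum -[RHS](Ex_const 1); apply: eq_Ex => s.
rewrite (bigD1 (pre s #|x|)) /=; last by rewrite inE subsetT card_pre ?card_leq_n ?eqxx.
rewrite onc_pre ?card_leq_n // big1 ?addr0 // => y.
rewrite !inE => /andP[/andP[_ /eqP cy] ne]; case: (boolP (onc s y)) => // /eqP e.
by rewrite -cy e eqxx in ne.
Qed.

Lemma lub_gt0 x : 0 < lub x.
Proof.
rewrite lt_neqAle lub_ge0 andbT; apply/eqP => e.
by have /eqP := lubE x; rewrite -e mul0r eq_sym oner_eq0.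
Qed.

(** By symmetry all supersets of [x] of size [#|y|] are equally likely to be visited together with
    [x], and a chain visits at most one of them. *)
Lemma lub2_up x y : x \subset y -> lub2 x y * 'C(n - #|x|, #|y| - #|x|)%:R <= lub x.
Proof.
move=> xy.
have -> : 'C(n - #|x|, #|y| - #|x|) =
    #|[set B : V | B \subset ~: x & #|B| == (#|y| - #|x|)%N]|.
  by rewrite cards_draws [#|~: x|]cardsCs setCK card_ord.
rewrite mulrC mulr_natl -sumr_const.
have -> : \sum_(B in [set B : V | B \subset ~: x & #|B| == (#|y| - #|x|)%N]) lub2 x y =
   \sum_(B in [set B : V | B \subset ~: x & #|B| == (#|y| - #|x|)%N]) lub2 x (x :|: B).
  apply: eq_bigr => B; rewrite inE => /andP[sB /eqP cB].
  apply: (@swap_invariant (lub2 x) (~: x)).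
  - move=> z e e'; rewrite !inE => ex ex'.
    by rewrite -{1}(tperm_out ex ex') lub2_mul.
  - rewrite cardsU cB (_ : x :&: B = set0) ?cards0 ?subn0 ?subnKC ?subset_leq_card //.
    by apply/eqP; rewrite setI_eq0 disjoint_sym disjoints_subset.
  - by apply/subsetP => i; rewrite !inE negb_or => /andP[/andP[-> _] _].
  - apply/subsetP => i; rewrite !inE => /andP[iy /orP[ix|iB]].
      by rewrite (subsetP xy _ ix) in iy.
    by have := subsetP sB _ iB; rewrite inE.
rewrite -Ex_sum; apply: ler_Ex => s.
case: (boolP (onc s x)) => /= ox; last by rewrite big1.
rewrite big_mkcond /=.
apply: (@le_trans _ _ (\sum_B ((B \in [set B : V | B \subset ~: x & #|B| == (#|y| - #|x|)%N])
     && onc s (x :|: B))%:R)).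
  by apply: ler_sum => B _; case: (_ \in _).
have cU B : B \in [set B : V | B \subset ~: x & #|B| == (#|y| - #|x|)%N] ->
   (#|x :|: B| = #|y|) /\ (x :|: B) :\: x = B.
  rewrite inE => /andP[sB /eqP cB].
  have dx : x :&: B = set0 by apply/eqP; rewrite setI_eq0 disjoint_sym disjoints_subset.
  split; first by rewrite cardsU cB dx cards0 subn0 subnKC ?subset_leq_card.
  by rewrite setDUl setDv set0U; apply/setDidPl; rewrite disjoints_subset.
apply: sum_indicator_le1 => B B' /andP[/cU[c1 e1] o1] /andP[/cU[c2 e2] o2].
by rewrite -e1 -e2 (onc_inj o1 o2) // c1 c2.
Qed.

Lemma lub2_down x y : x \subset y -> lub2 x y * 'C(#|y|, #|x|)%:R <= lub y.
Proof.
move=> xy; rewrite -cards_draws mulrC mulr_natl -sumr_const.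
have -> : \sum_(B in [set B : V | B \subset y & #|B| == #|x|]) lub2 x y =
   \sum_(B in [set B : V | B \subset y & #|B| == #|x|]) lub2 B y.
  apply: eq_bigr => B; rewrite inE => /andP[sB /eqP cB].
  apply: (@swap_invariant (lub2^~ y) y) => //.
  - by move=> z e e' ey ey'; rewrite -{1}(tperm_in ey ey') lub2_mul.
  - by apply/subsetP => i; rewrite !inE => /andP[_ /(subsetP xy)].
  - by apply/subsetP => i; rewrite !inE => /andP[_ /(subsetP sB)].
rewrite -Ex_sum; apply: ler_Ex => s.
rewrite big_mkcond /=.
apply: (@le_trans _ _ (\sum_(B : V) (((#|B| == #|x|) && onc s B) && onc s y)%:R)).
  by apply: ler_sum => B _; rewrite inE; case: (B \subset y); case: (_ == _).
case: (onc s y); last by rewrite big1 // => B _; rewrite andbF.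
apply: sum_indicator_le1 => B B'; rewrite !andbT => /andP[/eqP c1 o1] /andP[/eqP c2 o2].
by apply: (onc_inj o1 o2); rewrite c1 c2.
Qed.

(** On chains through [x] the elements outside [x] are exchangeable, and exactly [j - #|x|] of them
    belong to the member of size [j]. *)
Lemma chain_hits x (e : 'I_n) j : e \notin x -> (#|x| <= j <= n)%N ->
  Ex (fun s => (onc s x && (e \in pre s j))%:R) * (n - #|x|)%:R = (j - #|x|)%:R * lub x.
Proof.
move=> ex /andP[xj jn].
have -> : (n - #|x|)%N = #|~: x| by rewrite [RHS]cardsCs setCK card_ord.
rewrite mulr_natr -[LHS]sumr_const.
have -> : \sum_(i in ~: x) Ex (fun s => (onc s x && (e \in pre s j))%:R) =
   \sum_(i in ~: x) Ex (fun s => (onc s x && (i \in pre s j))%:R).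
  apply: eq_bigr => i; rewrite inE => ix.
  rewrite -[RHS](Ex_mul _ (tperm e i)); apply: eq_Ex => s.
  rewrite -{2}(tperm_out ex ix) onc_mul pre_mul; congr (_ && _)%:R.
  by rewrite -{1}(tpermL e i) mem_imset //; exact: perm_inj.
rewrite -Ex_sum -ExZ; apply: eq_Ex => s.
case: (boolP (onc s x)) => ox /=; last by rewrite mulr0 big1.
have -> : (j - #|x|)%N = #|pre s j :\: x|.
  have xs : x \subset pre s j by move/eqP: ox => <-; apply: pre_mono.
  by rewrite cardsD (setIidPr xs) card_pre.
rewrite mulr1 card_indicator big_mkcond; apply: eq_bigr => i _.
by rewrite !inE; case: (i \in x).
Qed.

Lemma chain_misses x (e : 'I_n) j : e \in x -> (j <= #|x|)%N ->
  Ex (fun s => (onc s x && (e \notin pre s j))%:R) * #|x|%:R = (#|x| - j)%:R * lub x.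
Proof.
move=> ex jx; rewrite mulr_natr -[LHS]sumr_const.
have -> : \sum_(i in x) Ex (fun s => (onc s x && (e \notin pre s j))%:R) =
   \sum_(i in x) Ex (fun s => (onc s x && (i \notin pre s j))%:R).
  apply: eq_bigr => i ix.
  rewrite -[RHS](Ex_mul _ (tperm e i)); apply: eq_Ex => s.
  rewrite -{2}(tperm_in ex ix) onc_mul pre_mul; congr (_ && ~~ _)%:R.
  by rewrite -{1}(tpermL e i) mem_imset //; exact: perm_inj.
rewrite -Ex_sum -ExZ; apply: eq_Ex => s.
case: (boolP (onc s x)) => ox /=; last by rewrite mulr0 big1.
have -> : (#|x| - j)%N = #|x :\: pre s j|.
  have xs : pre s j \subset x by move/eqP: ox => <-; apply: pre_mono.
  by rewrite cardsD (setIidPr xs) card_pre // (leq_trans jx) // card_leq_n.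
rewrite mulr1 card_indicator big_mkcond; apply: eq_bigr => i _.
by rewrite !inE andbC; case: (i \in x).
Qed.

(** The trace of the chain on [G], in increasing order. Ranks of [P] are matched with positions in
    this list, not with levels of the cube. *)
Definition cG G s : seq V := [seq x <- [seq pre s j | j <- iota 0 n.+1] | x \in G].

Lemma mem_cG G s x : (x \in cG G s) = onc s x && (x \in G).
Proof.
rewrite mem_filter andbC; congr (_ && _); apply/mapP/idP => [[j]|o].
  by rewrite mem_iota add0n ltnS => /= jn ->; apply: onc_pre.
by exists #|x|; [rewrite mem_iota /= add0n ltnS card_leq_n | rewrite (eqP o)].
Qed.

Lemma cG_sorted G s : sorted (fun x y => #|x| < #|y|)%N (cG G s).
Proof.
apply: sorted_filter; first by move=> a b c; apply: ltn_trans.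
rewrite sorted_map; apply: (@sub_in_sorted _ (fun i => i \in iota 0 n.+1) ltn); last exact: iota_ltn_sorted.
  by move=> i j; rewrite !mem_iota !add0n !ltnS /= => hi hj; rewrite !card_pre.
exact/allP.
Qed.

Lemma cG_uniq G s : uniq (cG G s).
Proof.
apply: (@sorted_uniq _ (fun x y => #|x| < #|y|)%N); last exact: cG_sorted.
- by move=> a b c; apply: ltn_trans.
- by move=> a; rewrite ltnn.
Qed.

Lemma cG_index G s x y : x \in cG G s -> y \in cG G s ->
  (index x (cG G s) < index y (cG G s))%N -> x \proper y.
Proof.
move=> hx hy lt.
have c : (#|x| < #|y|)%N.
  have tr : transitive (fun x y : V => #|x| < #|y|)%N by move=> a b d; apply: ltn_trans.
  exact: (sorted_ltn_index tr (cG_sorted G s) x y hx hy lt).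
move: hx hy; rewrite !mem_cG => /andP[ox _] /andP[oy _].
by rewrite properEcard (onc_sub ox oy (ltnW c)) c.
Qed.

Lemma Ex_size_cG G : Ex (fun s => (size (cG G s))%:R) = \sum_(x in G) lub x.
Proof.
rewrite -Ex_sum; apply: eq_Ex => s.
rewrite -(card_uniqP (cG_uniq G s)) card_indicator [RHS]big_mkcond.
apply: eq_bigr => x _; rewrite mem_cG andbC.
by case: (x \in G).
Qed.

Lemma size_cG G s : (size (cG G s) <= n.+1)%N.
Proof. by rewrite size_filter (leq_trans (count_size _ _)) // size_map size_iota. Qed.

End RandomChain.

(** * Transition kernels of the trace of a chain *)

Section ChainKernel.
Local Open Scope ring_scope.
Variables (R : realFieldType) (n : nat) (G : {set {set 'I_n}}).
Local Notation V := {set 'I_n}.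
Local Notation Ex := (@Ex R n).
Local Notation lub := (@lub R n).
Local Notation lub2 := (@lub2 R n).
Implicit Types (s : {perm 'I_n}) (x y z w : V).

Definition mu x : R := lub x * (x \in G)%:R.

Lemma mu_ge0 x : 0 <= mu x.
Proof. by rewrite mulr_ge0 ?lub_ge0. Qed.

Lemma mu_in x : x \in G -> mu x = lub x.
Proof. by rewrite /mu => ->; rewrite mulr1. Qed.

Lemma mu_gt0 x : (0 < mu x) = (x \in G).
Proof. by rewrite /mu; case: (x \in G); rewrite ?mulr1 ?lub_gt0 // mulr0 ltxx. Qed.

Lemma mu_Ex x : mu x = Ex (fun s => (x \in cG G s)%:R).
Proof.
rewrite /mu mulrC -ExZ; apply: eq_Ex => s; rewrite mem_cG.
by case: (x \in G); rewrite ?mul1r ?andbT // mul0r andbF.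
Qed.

(** An equation between sums, because differences of indices would truncate. *)
Definition ev i j z x s : bool :=
  [&& z \in cG G s, x \in cG G s & index z (cG G s) + j == index x (cG G s) + i]%N.

(* The probability that a random maximal chain contains [z] and [x] with
   positions in its trace on [G] differing by [j - i]. *)
Definition Q i j z x : R := Ex (fun s => (ev i j z x s)%:R).

Lemma ev_sym i j z x s : ev i j z x s = ev j i x z s.
Proof. by rewrite /ev eq_sym; case: (z \in _); case: (x \in _). Qed.

Lemma Q_sym i j z x : Q i j z x = Q j i x z.
Proof. by apply: eq_Ex => s; rewrite ev_sym. Qed.

Lemma Q_ge0 i j z x : 0 <= Q i j z x.
Proof. exact: Ex_ge0. Qed.

Lemma ev_inj i j z x y s : ev i j z x s -> ev i j z y s -> x = y.
Proof.
case/and3P=> _ hx /eqP e1 /and3P[_ hy /eqP e2].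
have e : index x (cG G s) = index y (cG G s) by apply: (@addIn i); rewrite -e1.
by rewrite -(nth_index set0 hx) e nth_index.
Qed.

Lemma Q_sum i j z : \sum_x Q i j z x <= mu z.
Proof.
rewrite mu_Ex -Ex_sum; apply: ler_Ex => s.
have [hz|hz] := boolP (z \in cG G s); last first.
  by rewrite big1 // => x _; rewrite /ev (negPf hz).
by apply: sum_indicator_le1 => x y; exact: ev_inj.
Qed.

Lemma ev_lt i j z x s : (i < j)%N -> ev i j z x s -> z \proper x.
Proof.
move=> ij /and3P[hz hx /eqP e]; apply: (cG_index hz hx).
by rewrite -(ltn_add2r i) -e ltn_add2l.
Qed.

Lemma ev_gt i j z x s : (j < i)%N -> ev i j z x s -> x \proper z.
Proof. by rewrite ev_sym; exact: ev_lt. Qed.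

Lemma Q_neq0 i j z x : Q i j z x != 0 -> exists s, ev i j z x s.
Proof.
move=> h; apply/existsP; apply: contraNT h => /existsPn h.
by rewrite /Q (eq_Ex (g := fun=> 0)) ?Ex_const // => s; rewrite (negPf (h s)).
Qed.

Lemma Q_le_lub2 i j z x : Q i j z x <= lub2 z x.
Proof.
apply: ler_Ex => s; rewrite ler_nat; case: (boolP (ev _ _ _ _ _)) => // /and3P[].
by rewrite !mem_cG => /andP[-> _] /andP[-> _].
Qed.

(** * Degree bounds for the kernels *)

Section Degree.
Variable tau : R.
Hypothesis tau_gt0 : 0 < tau.
Hypothesis tau_bin : forall x y, x \in G -> y \in G -> x \proper y ->
  1 <= tau * 'C(n - #|x|, #|y| - #|x|)%:R /\ 1 <= tau * 'C(#|y|, #|x|)%:R.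

Lemma Q_tau i j z x : i != j -> Q i j z x <= tau * mu z.
Proof.
move=> ij; have [->|/Q_neq0[s es]] := eqVneq (Q i j z x) 0.
  by rewrite mulr_ge0 ?mu_ge0 // ltW.
have [zG xG] : z \in G /\ x \in G.
  by case/and3P: es; rewrite !mem_cG => /andP[_ ->] /andP[_ ->].
apply: le_trans (Q_le_lub2 _ _ _ _) _; rewrite mu_in //.
have l0 : 0 <= lub2 z x by apply: Ex_ge0.
case: (ltngtP i j) ij => // ij _.
  have zx := ev_lt ij es; have [h _] := tau_bin zG xG zx.
  apply: (@le_trans _ _ (lub2 z x * (tau * 'C(n - #|z|, #|x| - #|z|)%:R))).
    by rewrite ler_peMr.
  by rewrite mulrCA ler_pM2l // lub2_up // proper_sub.
have xz := ev_gt ij es; have [_ h] := tau_bin xG zG xz.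
apply: (@le_trans _ _ (lub2 z x * (tau * 'C(#|z|, #|x|)%:R))).
  by rewrite ler_peMr.
rewrite mulrCA ler_pM2l //; have := lub2_down R (proper_sub xz).
by rewrite /lub2; under eq_Ex do rewrite andbC.
Qed.

Lemma Q_kernel i j : i != j -> kernel mu tau (Q i j).
Proof.
move=> ij; split=> [z x|z|x|z x|z x].
- exact: Q_ge0.
- exact: Q_sum.
- by under eq_bigr do rewrite Q_sym; exact: Q_sum.
- exact: Q_tau.
- by rewrite Q_sym; apply: Q_tau; rewrite eq_sym.
Qed.

End Degree.

(** * Windows of consecutive trace members *)

Section Cleaning.
Variables (k : nat) (eta : R).
Hypotheses (k_gt0 : (0 < k)%N) (eta_ge0 : 0 <= eta).

(* Restricting to windows of consecutive members of the trace keeps the weight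
   through any vertex below [mu], while [nu setT] is still the excess of the
   Lubell mass over [k - 1]. *)
Definition win (J : {set 'I_k * V}) s t :=
  (t + k <= size (cG G s))%N && [forall i : 'I_k, (i, nth set0 (cG G s) (t + i)) \in J].

Definition nu J : R := Ex (fun s => \sum_(t < n.+1) (win J s t)%:R).

Lemma win_lt J s t (i : 'I_k) : win J s t -> (t + i < size (cG G s))%N.
Proof. by case/andP=> h _; apply: leq_trans h; rewrite ltn_add2l. Qed.

(** A trace with m members has m - (k - 1) windows if this is nonnegative, and none otherwise. *)
Lemma nu_setT : \sum_x mu x - (k%:R - 1) <= nu setT.
Proof.
have -> : \sum_x mu x = Ex (fun s => (size (cG G s))%:R).
  by rewrite Ex_size_cG [RHS]big_mkcond; apply: eq_bigr => x _; rewrite /mu; case: (x \in G); rewrite ?mulr1 ?mulr0.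
rewrite -(Ex_const n (k%:R - 1)) -ExB; apply: ler_Ex => s.
have le := size_cG G s; set m := size _ in le *.
have e : \sum_(t < n.+1) (win setT s t)%:R = (m.+1 - k)%:R :> R.
  transitivity (\sum_(t < n.+1 | (t < m.+1 - k)%N) 1 : R).
    rewrite [RHS]big_mkcond; apply: eq_bigr => t _.
    have -> : win setT s t = (t < m.+1 - k)%N.
      rewrite /win (_ : [forall i, _]); last by apply/forallP => i; rewrite inE.
      by rewrite andbT ltn_subRL addnC ltnS.
    by case: ifP.
  have le' : (m.+1 - k <= n.+1)%N by rewrite leq_subLR; lia.
  by rewrite -(big_ord_widen n.+1 (fun=> 1) le') sumr_const card_ord.
rewrite e; have [km|mk] := leqP k m.+1.
  by rewrite natrB // -addn1 natrD; lra.
have : m.+1%:R <= k%:R :> R by rewrite ler_nat ltnW.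
rewrite -addn1 natrD => h; apply: le_trans (_ : 0 <= _); [lra | exact: ler0n].
Qed.

(** Different windows of one trace have different members at position [i]. *)
Lemma nu_le J (i : 'I_k) : nu J <= \sum_(x | (i, x) \in J) mu x.
Proof.
under eq_bigr do rewrite mu_Ex.
rewrite -Ex_sum; apply: ler_Ex => s; rewrite sum_indicator [leRHS]big_mkcond /=.
rewrite (eq_bigr (fun x => ((x \in cG G s) && ((i, x) \in J))%:R)); last first.
  by move=> x _; rewrite andbC; case: (_ \in J).
rewrite sum_indicator ler_nat.
rewrite -(card_in_image (f := fun t : 'I_n.+1 => nth set0 (cG G s) (t + i))).
  apply/subset_leq_card/subsetP => x /imageP[t wt ->]; rewrite unfold_in.
  rewrite mem_nth ?(win_lt _ wt) //=.
  by case/andP: wt => _ /forallP.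
move=> t t' wt wt' /eqP.
rewrite nth_uniq ?cG_uniq ?(win_lt _ wt) ?(win_lt _ wt') // eqn_add2r => /eqP e.
exact: val_inj.
Qed.

(** A trace contains [x] at most once, so deleting [(i, x)] destroys at most one of its windows, and
    that window has an allowed member [y] at position [j]. *)
Lemma nu_diff J (i j : 'I_k) x :
  nu J - nu (J :\ (i, x)) <= \sum_(y | (j, y) \in J) Q i j x y.
Proof.
rewrite -Ex_sum /nu -ExB; apply: ler_Ex => s; rewrite -sumrB.
pose w (t : 'I_n.+1) := win J s t && ~~ win (J :\ (i, x)) s t.
apply: (@le_trans _ _ (\sum_t (w t)%:R)).
  by apply: ler_sum => t _; rewrite /w; case: (win J s t); case: (win _ s t); rewrite /= ?subrr ?subr0 // sub0r oppr_le0.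
have wE t : w t -> win J s t /\ nth set0 (cG G s) (t + i) = x.
  case/andP=> wt nwt; split=> //; case/andP: (wt) => h1 /forallP h2.
  move: nwt; rewrite /win h1 /= negb_forall => /existsP[i'].
  by rewrite !inE h2 andbT negbK => /eqP[-> ->].
have w1 t t' : w t -> w t' -> t = t'.
  move=> /wE[wt e] /wE[wt' e']; apply/val_inj/(@addIn i)/eqP.
  by rewrite -(nth_uniq set0 _ _ (cG_uniq G s)) ?(win_lt _ wt) ?(win_lt _ wt') // e e'.
case: (pickP w) => [t wt|w0]; last first.
  by rewrite big1 => [|t _]; [apply: sumr_ge0 | rewrite w0].
apply: le_trans (sum_indicator_le1 R w1) _.
have [wt' e] := wE t wt.
pose y := nth set0 (cG G s) (t + j).
have yJ : (j, y) \in J by case/andP: wt' => _ /forallP.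
rewrite (bigD1 y) //= (_ : ev _ _ _ _ _) ?lerDl ?sumr_ge0 //.
rewrite /ev -e !mem_nth ?(win_lt _ wt') //= !index_uniq ?cG_uniq ?(win_lt _ wt') //.
by rewrite addnAC.
Qed.

Lemma cleaning : exists L : nat -> {set V},
  (forall i j x, (i < k)%N -> (j < k)%N -> x \in L i ->
     eta * mu x <= \sum_(y in L j) Q i j x y) /\
  (forall i, (i < k)%N ->
     \sum_x mu x - (k%:R - 1) - eta * k%:R * \sum_x mu x <= \sum_(x in L i) mu x).
Proof.
(* At a maximiser of [Phi], dropping a pair [(i, x)] destroys windows of weight at
   least [eta * mu x]. *)
pose Phi J := nu J + eta * \sum_(p in ~: J) mu p.2.
have [J _ hJ] := @arg_maxP _ _ {set 'I_k * V} setT xpredT Phi isT.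
have {}hJ J' : Phi J' <= Phi J by exact: hJ.
pose i0 := Ordinal k_gt0.
have oE i : (i < k)%N -> insubd i0 i = i :> nat by move=> h; rewrite val_insubd h.
exists (fun i => [set x | (insubd i0 i, x) \in J]); split.
  move=> i j x hi hj; rewrite inE => xJ.
  have := hJ (J :\ (insubd i0 i, x)); rewrite /Phi.
  have -> : ~: (J :\ (insubd i0 i, x)) = (insubd i0 i, x) |: ~: J.
    by apply/setP => p; rewrite !inE negb_and negbK.
  rewrite big_setU1 /=; last by rewrite inE xJ.
  rewrite mulrDr => h; have := nu_diff J (insubd i0 i) (insubd i0 j) x.
  rewrite !oE // => h'; rewrite (eq_bigl (fun y => (insubd i0 j, y) \in J)) => [|y].
    lra.
  by rewrite inE.
move=> i hi; rewrite [leRHS](eq_bigl (fun y => (insubd i0 i, y) \in J)) => [|y]; last by rewrite inE.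
apply: le_trans (nu_le J (insubd i0 i)).
have := hJ setT; rewrite /Phi setCT big_set0 mulr0 addr0.
have h1 : \sum_(p in ~: J) mu p.2 <= k%:R * \sum_x mu x.
  apply: (@le_trans _ _ (\sum_(p in [set: 'I_k * V]) mu p.2)).
    by apply: ler_sum_subset; rewrite ?subsetT // => p; exact: mu_ge0.
  rewrite (eq_bigl xpredT) => [|p]; last by rewrite inE.
  by rewrite -(pair_big xpredT xpredT (fun _ x => mu x)) /= sumr_const card_ord mulr_natl.
have h2 := ler_wpM2l eta_ge0 h1; rewrite mulrA in h2; have h3 := nu_setT => h4. lra.
Qed.

End Cleaning.

(** * Wrong comparabilities are rare in a narrow band *)

Section Bad.
Variables (a b : nat) (beta : R).
Hypotheses (band : forall x, x \in G -> (a <= #|x| <= b)%N) (a_gt0 : (0 < a)%N) (b_lt : (b < n)%N).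
Hypotheses (beta_up : (b - a)%:R <= beta * (n - b)%:R) (beta_down : (b - a)%:R <= beta * a%:R).

(* Attaching [y] to [z] creates a wrong comparability with [w]. *)
Definition bad z w y : bool :=
  if z \subset y then (~~ (w \subset z) && (w \subset y)) || (y \subset w)
  else (~~ (z \subset w) && (y \subset w)) || (w \subset y).

Lemma beta_ge0 : 0 <= beta.
Proof.
have h : 0 <= beta * a%:R by apply: le_trans beta_down.
by rewrite pmulr_lge0 // ?ltr0n in h.
Qed.

Lemma hit_bound z (e : 'I_n) j c : z \in G -> e \notin z -> (#|z| <= j <= n)%N ->
  (j - #|z| <= c)%N -> Ex (fun s => (onc s z && (e \in pre s j))%:R) * (n - b)%:R <= c%:R * lub z.
Proof.
move=> zG ez hj hc; have := chain_hits R ez hj => e0.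
apply: (@le_trans _ _ (Ex (fun s => (onc s z && (e \in pre s j))%:R) * (n - #|z|)%:R)).
  apply: ler_wpM2l; first exact: Ex_ge0.
  by rewrite ler_nat leq_sub2l //; case/andP: (band zG).
by rewrite e0 ler_wpM2r ?lub_ge0 // ler_nat.
Qed.

Lemma miss_bound z (e : 'I_n) j c : z \in G -> e \in z -> (j <= #|z|)%N ->
  (#|z| - j <= c)%N -> Ex (fun s => (onc s z && (e \notin pre s j))%:R) * a%:R <= c%:R * lub z.
Proof.
move=> zG ez hj hc; have := chain_misses R ez hj => e0.
apply: (@le_trans _ _ (Ex (fun s => (onc s z && (e \notin pre s j))%:R) * #|z|%:R)).
  apply: ler_wpM2l; first exact: Ex_ge0.
  by rewrite ler_nat; case/andP: (band zG).
by rewrite e0 ler_wpM2r ?lub_ge0 // ler_nat.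
Qed.

(** If [w] is below [y] but not below [z], a fixed element of [w :\: z] is hit by level [b] (event
    [E1]). If [y] is below [w], the first element added after [z] lies in [w :\: z] (event [E2]).
    Each costs at most [beta]. *)
Lemma bad_up i j z w : z \in G -> w \in G -> (i < j)%N ->
  \sum_(y | bad z w y) Q i j z y <= 2 * beta * mu z.
Proof.
move=> zG wG ij; rewrite -Ex_sum mu_in //.
have /andP[az zb] := band zG; have /andP[aw wb] := band wG.
have nb : 0 < (n - b)%:R :> R by rewrite ltr0n subn_gt0.
have zn : (#|z| < n)%N by apply: leq_ltn_trans b_lt.
pose E1 s : R := if [pick e in w :\: z] is Some e then (onc s z && (e \in pre s b))%:R else 0.
pose E2 s : R := if z \subset w then
  \sum_(e in w :\: z) (onc s z && (e \in pre s #|z|.+1))%:R else 0.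
have E10 s : 0 <= E1 s by rewrite /E1; case: pickP.
have E20 s : 0 <= E2 s by rewrite /E2; case: ifP => // _; apply: sumr_ge0.
have b1 : Ex E1 <= beta * lub z.
  rewrite /E1; case: pickP => [e|_]; last by rewrite Ex_const mulr_ge0 ?beta_ge0 ?lub_ge0.
  rewrite inE => /andP[ez _].
  have := @hit_bound z e b (b - a) zG ez; rewrite zb (ltnW b_lt) leq_sub2l // => /(_ isT isT) h.
  rewrite -(ler_pM2r nb) (le_trans h) // mulrAC.
  by rewrite ler_wpM2r // lub_ge0.
have b2 : Ex E2 <= beta * lub z.
  rewrite /E2; case: (boolP (z \subset w)) => zw; last by rewrite Ex_const mulr_ge0 ?beta_ge0 ?lub_ge0.
  rewrite Ex_sum -(ler_pM2r nb) mulr_suml.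
  apply: (@le_trans _ _ (\sum_(e in w :\: z) lub z)).
    apply: ler_sum => e; rewrite inE => /andP[ez _].
    have := @hit_bound z e #|z|.+1 1 zG ez; rewrite leqnSn zn subSn // subnn mul1r.
    exact.
  rewrite sumr_const cardsD (setIidPr zw) -[leLHS]mulr_natl mulrAC ler_wpM2r ?lub_ge0 //.
  by apply: le_trans beta_up; rewrite ler_nat leq_sub.
apply: (@le_trans _ _ (Ex E1 + Ex E2)); last by lra.
rewrite -ExD; apply: ler_Ex => s.
rewrite big_mkcond /= (eq_bigr (fun y => (bad z w y && ev i j z y s)%:R)); last first.
  by move=> y _; case: (bad _ _ _).
case: (pickP (fun y => bad z w y && ev i j z y s)) => [y|h]; last first.
  by rewrite big1 => [|y _]; [rewrite addr_ge0 | rewrite h].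
case/andP=> bd es; apply: (@le_trans _ _ 1).
  by apply: sum_indicator_le1 => x x' /andP[_ h1] /andP[_ h2]; exact: ev_inj h1 h2.
have zy := ev_lt ij es.
have [oz oy yG] : [/\ onc s z, onc s y & y \in G].
  by case/and3P: es; rewrite !mem_cG => /andP[-> _] /andP[-> ->].
have yb : y \subset pre s b.
  by rewrite -{1}(eqP oy); apply: pre_mono; case/andP: (band yG).
move: bd; rewrite /bad (proper_sub zy) => /orP[/andP[wz wy]|yw].
  suff : 1 <= E1 s by have := E20 s; lra.
  rewrite /E1; case: pickP => [e|h].
    by rewrite inE => /andP[_ ew]; rewrite oz (subsetP yb) //= (subsetP wy).
  case/negP: wz; apply/subsetP => e ew; apply: contraFT (h e) => ez.
  by rewrite inE ez.
suff : 1 <= E2 s by have := E10 s; lra.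
have zw : z \subset w := subset_trans (proper_sub zy) yw.
have py : pre s #|z|.+1 \subset y.
  by rewrite -(eqP oy); apply: pre_mono; apply: proper_card.
have /card_gt0P[e] : (0 < #|pre s #|z|.+1 :\: z|)%N.
  have zp : z \subset pre s #|z|.+1 by rewrite -{1}(eqP oz) pre_mono.
  by rewrite cardsD (setIidPr zp) card_pre // subn_gt0.
rewrite inE => /andP[ez ep].
rewrite /E2 zw (bigD1 e) /=; last by rewrite inE ez (subsetP yw) // (subsetP py).
by rewrite oz ep lerDl sumr_ge0.
Qed.

(** Dually, either a fixed element of [z :\: w] is missing at level [a], or the element removed just
    below [z] lies in [z :\: w]. *)
Lemma bad_down i j z w : z \in G -> w \in G -> (j < i)%N ->
  \sum_(y | bad z w y) Q i j z y <= 2 * beta * mu z.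
Proof.
move=> zG wG ji; rewrite -Ex_sum mu_in //.
have /andP[az zb] := band zG; have /andP[aw wb] := band wG.
have a0 : 0 < a%:R :> R by rewrite ltr0n.
have z0 : (0 < #|z|)%N by apply: leq_trans az.
pose E1 s : R := if [pick e in z :\: w] is Some e then (onc s z && (e \notin pre s a))%:R else 0.
pose E2 s : R := if w \subset z then
  \sum_(e in z :\: w) (onc s z && (e \notin pre s #|z|.-1))%:R else 0.
have E10 s : 0 <= E1 s by rewrite /E1; case: pickP.
have E20 s : 0 <= E2 s by rewrite /E2; case: ifP => // _; apply: sumr_ge0.
have b1 : Ex E1 <= beta * lub z.
  rewrite /E1; case: pickP => [e|_]; last by rewrite Ex_const mulr_ge0 ?beta_ge0 ?lub_ge0.
  rewrite inE => /andP[_ ez].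
  have := @miss_bound z e a (b - a) zG ez az; rewrite leq_sub2r // => /(_ isT) h.
  rewrite -(ler_pM2r a0) (le_trans h) // mulrAC.
  by rewrite ler_wpM2r // lub_ge0.
have b2 : Ex E2 <= beta * lub z.
  rewrite /E2; case: (boolP (w \subset z)) => zw; last by rewrite Ex_const mulr_ge0 ?beta_ge0 ?lub_ge0.
  rewrite Ex_sum -(ler_pM2r a0) mulr_suml.
  apply: (@le_trans _ _ (\sum_(e in z :\: w) lub z)).
    apply: ler_sum => e; rewrite inE => /andP[_ ez].
    have := @miss_bound z e #|z|.-1 1 zG ez; rewrite leq_pred mul1r; apply=> //.
    by rewrite -subn1 subKn.
  rewrite sumr_const cardsD (setIidPr zw) -[leLHS]mulr_natl mulrAC ler_wpM2r ?lub_ge0 //.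
  by apply: le_trans beta_down; rewrite ler_nat leq_sub.
apply: (@le_trans _ _ (Ex E1 + Ex E2)); last by lra.
rewrite -ExD; apply: ler_Ex => s.
rewrite big_mkcond /= (eq_bigr (fun y => (bad z w y && ev i j z y s)%:R)); last first.
  by move=> y _; case: (bad _ _ _).
case: (pickP (fun y => bad z w y && ev i j z y s)) => [y|h]; last first.
  by rewrite big1 => [|y _]; [rewrite addr_ge0 | rewrite h].
case/andP=> bd es; apply: (@le_trans _ _ 1).
  by apply: sum_indicator_le1 => x x' /andP[_ h1] /andP[_ h2]; exact: ev_inj h1 h2.
have yz := ev_gt ji es.
have [oz oy yG] : [/\ onc s z, onc s y & y \in G].
  by case/and3P: es; rewrite !mem_cG => /andP[-> _] /andP[-> ->].
have ya : pre s a \subset y.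
  by rewrite -(eqP oy); apply: pre_mono; case/andP: (band yG).
have nzy : (z \subset y) = false by apply: contraTF yz => h; rewrite properE h andbF.
move: bd; rewrite /bad nzy => /orP[/andP[zw yw]|wy].
  suff : 1 <= E1 s by have := E20 s; lra.
  rewrite /E1; case: pickP => [e|h].
    rewrite inE => /andP[ew _]; rewrite oz /=.
    by rewrite (contra _ ew) // => /(subsetP ya) /(subsetP yw).
  case/negP: zw; apply/subsetP => e ew; apply: contraFT (h e) => ez.
  by rewrite inE ez.
suff : 1 <= E2 s by have := E10 s; lra.
have wz : w \subset z := subset_trans wy (proper_sub yz).
have py : y \subset pre s #|z|.-1.
  rewrite -{1}(eqP oy); apply: pre_mono; rewrite -ltnS prednK //; exact: proper_card.
have /card_gt0P[e] : (0 < #|z :\: pre s #|z|.-1|)%N.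
  have zp : pre s #|z|.-1 \subset z by rewrite -{2}(eqP oz) pre_mono // leq_pred.
  rewrite cardsD (setIidPr zp) card_pre ?subn_gt0 ?prednK //.
  by rewrite (leq_trans (leq_pred _)) // card_leq_n.
rewrite inE => /andP[ez ep].
rewrite /E2 wz (bigD1 e) /=; last first.
  by rewrite inE ep andbT; apply: contra ez => /(subsetP wy) /(subsetP py).
by rewrite oz ez lerDl sumr_ge0.
Qed.

End Bad.
End ChainKernel.

(** * Weighted copies of a tree poset *)

Lemma mulf4_neq0 (F : fieldType) (p q r t : F) :
  (p * (q / r) * t != 0 -> [/\ p != 0, q != 0 & t != 0])%R.
Proof. by rewrite !mulf_eq0 !negb_or => /andP[/andP[-> /andP[-> _]] ->]. Qed.

Section CopyWeight.
Local Open Scope ring_scope.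
Variables (R : realFieldType) (n : nat) (G : {set {set 'I_n}}).
Variables (d : Order.disp_t) (P : finPOrderType d) (L : nat -> {set {set 'I_n}}).
Local Notation V := {set 'I_n}.
Local Notation mu := (@mu R n G).
Local Notation Q := (@Q R n G).
Implicit Types (x y z w : V) (vs : seq P) (xs : seq V).

Definition link_ker (v p : P) z x : R := Q (rk p) (rk v) z x.

Lemma link_ker_ge0 v p z x : 0 <= link_ker v p z x.
Proof. exact: Q_ge0. Qed.

(** A tree weight multiplied by two indicators, one for the cleaned position sets and one against
    wrong comparabilities. Positions in the trace differ as the ranks do, so [p < v] forces [z] to
    be a proper subset of [x]. *)
Fixpoint copy_weight vs xs : R :=
  match vs, xs with
  | v :: vs', x :: xs' =>
      (x \in L (rk v))%:R *
      (if vs' is [::] then mu x else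
       let i := find (hasse_adj v) vs' in
       let z := nth set0 xs' i in
       copy_weight vs' xs' * (link_ker v (par v vs') z x / mu z) *
       (all (fun w => ~~ bad z w x) xs')%:R)
  | _, _ => 0
  end.

Fixpoint kers vs : seq (nat * (V -> V -> R)) :=
  if vs is v :: vs' then
    if vs' is [::] then [::]
    else (find (hasse_adj v) vs', link_ker v (par v vs')) :: kers vs'
  else [::].

Lemma size_kers vs : size (kers vs) = (size vs).-1.
Proof. by elim: vs => [|v [|v' vs] IH] //=; rewrite IH. Qed.

Lemma copy_weight_ge0 vs xs : 0 <= copy_weight vs xs.
Proof.
elim: vs xs => [|v vs IH] [|x xs] //=.
case: vs IH => [|v' vs] IH /=; first by rewrite mulr_ge0 ?mu_ge0.
by apply: mulr_ge0 => //; rewrite mulr_ge0 // mulr_ge0 ?IH // divr_ge0 ?mu_ge0 ?Q_ge0.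
Qed.

Lemma hasse_rk (v p : P) : hasse_adj v p -> rk p != rk v.
Proof.
by case/orP=> /covers_lt /rk_mono; rewrite ltn_neqAle => /andP[]; rewrite 1?eq_sym.
Qed.

Lemma par_adj (v : P) vs : has (hasse_adj v) vs -> hasse_adj v (par v vs).
Proof. exact: nth_find. Qed.

(** * Codegrees of the weight on copies *)

Section Upper.
Variable tau : R.
Hypothesis tau_gt0 : 0 < tau.
Hypothesis tau_bin : forall x y, x \in G -> y \in G -> x \proper y ->
  1 <= tau * 'C(n - #|x|, #|y| - #|x|)%:R /\ 1 <= tau * 'C(#|y|, #|x|)%:R.

Lemma kers_kernels vs : leaf_order vs -> kernels mu tau (kers vs).
Proof.
elim: vs => [|v [|v' vs] IH] //; case=> [//|[lo _ hv _]].
split; last exact: IH.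
  by rewrite size_kers; move: hv; rewrite has_find.
by apply: Q_kernel => //; apply: hasse_rk; exact: par_adj.
Qed.

Lemma copy_weight_le vs xs : leaf_order vs -> size xs = size vs ->
  copy_weight vs xs <= tree_weight mu (kers vs) xs.
Proof.
elim: vs xs => [|v vs IH] [|x xs] //= lo [sx].
have b1 (c : bool) (r : R) : 0 <= r -> c%:R * r <= r.
  by move=> r0; rewrite ler_piMl // lern1 leq_b1.
have b2 (c : bool) (r : R) : 0 <= r -> r * c%:R <= r.
  by move=> r0; rewrite mulrC b1.
case: vs IH lo sx => [|v' vs] IH lo sx; first by rewrite b1 ?mu_ge0.
case: lo => // -[lo _ hv _].
have hi : (find (hasse_adj v) (v' :: vs) < size xs)%N by rewrite sx -has_find.
set vs' := v' :: vs in IH lo hv sx hi *; set i := find _ _ in hi *.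
set z := nth set0 xs i.
have -> : tree_weight mu (kers (v :: vs')) (x :: xs) = tree_weight mu (kers vs') xs *
    (link_ker v (par v vs') (nth x xs i) x / mu (nth x xs i)) by [].
rewrite (set_nth_default set0) // -/z.
have w0 : 0 <= link_ker v (par v vs') z x / mu z.
  by apply: divr_ge0; [exact: link_ker_ge0 | exact: mu_ge0].
apply: le_trans (b1 _ _ _) _; first by rewrite mulr_ge0 // mulr_ge0 // copy_weight_ge0.
apply: le_trans (b2 _ _ _) _; first by rewrite mulr_ge0 ?copy_weight_ge0.
by rewrite ler_wpM2r // IH.
Qed.

Lemma copy_weight_spread vs : leaf_order vs -> vs != [::] ->
  spread mu tau 1 (size vs) (copy_weight vs).
Proof.
move=> lo ne os a so aos.
have sz : (size (kers vs)).+1 = size vs by rewrite size_kers prednK // lt0n size_eq0.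
have := tree_weight_spread (@mu_ge0 R n G) tau_gt0 (kers_kernels lo).
rewrite sz => /(_ os a so aos); apply: le_trans; apply: ler_psum => xs /compat_size sx.
by apply: copy_weight_le => //; rewrite sx.
Qed.

End Upper.

Lemma copy_weight_supp vs xs : leaf_order vs -> size xs = size vs ->
  copy_weight vs xs != 0 ->
  forall i, (i < size xs)%N -> nth set0 xs i \in G /\
     forall v0, nth set0 xs i \in L (rk (nth v0 vs i)).
Proof.
elim: vs xs => [|v vs IH] [|x xs] //= lo [sx].
rewrite mulf_eq0 negb_or pnatr_eq0 eqb0 negbK => /andP[xL].
case: vs IH lo sx => [|v' vs] IH lo sx.
  move=> h [|i] //=; last by case: (xs) sx.
  by split=> //; rewrite -(mu_gt0 R) lt_neqAle eq_sym h mu_ge0.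
case: lo => // -[lo _ hv _].
case/mulf4_neq0=> w0 q0 _ [|i] hi; last exact: (IH xs lo sx w0 i hi).
split=> //; have [s] := Q_neq0 q0.
by case/and3P=> _; rewrite mem_cG => /andP[].
Qed.

(** The relations of the leaf [v] to earlier vertices are those of its neighbour, by [leaf_order];
    the inclusions between [x] and earlier sets are those of [z], because no earlier set is bad.
    Induction matches the two. *)
Lemma copy_weight_induced vs xs : leaf_order vs -> size xs = size vs ->
  copy_weight vs xs != 0 -> forall v0 i j, (i < size xs)%N -> (j < size xs)%N ->
  (nth v0 vs i <= nth v0 vs j)%O = (nth set0 xs i \subset nth set0 xs j).
Proof.
elim: vs xs => [|v vs IH] [|x xs] //= lo [sx].
rewrite mulf_eq0 negb_or => /andP[_].
case: vs IH lo sx => [|v' vs] IH lo sx.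
  by case: xs sx => // _ _ v0 [|i] [|j] //= _ _; rewrite lexx subxx.
case: lo => // -[lo vn hv rel].
set ii := find _ _; set z := nth set0 xs ii.
case/mulf4_neq0=> w0 q0.
rewrite pnatr_eq0 eqb0 negbK => /allP nb v0.
have {}IH := IH xs lo sx w0.
have hii : (ii < size xs)%N by rewrite sx -has_find.
have parE : par v (v' :: vs) = nth v0 (v' :: vs) ii.
  by rewrite /par; apply: set_nth_default; rewrite -sx.
have [s es] := Q_neq0 q0.
have cmp i : (i < size xs)%N ->
    (nth v0 (v' :: vs) i <= v)%O = (nth set0 xs i \subset x) /\
    (v <= nth v0 (v' :: vs) i)%O = (x \subset nth set0 xs i).
  move=> hi; set u := nth _ _ i; set w := nth _ _ i.
  have uvs : u \in v' :: vs by rewrite mem_nth // -sx.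
  have nbw : ~~ bad z w x by apply: nb; apply: mem_nth.
  have := IH v0 i ii hi hii; have := IH v0 ii i hii hi; rewrite -parE -/u -/w -/z.
  case: rel => -[ltp /(_ _ uvs)[-> ->]] e1 e2.
    have zx := ev_lt (rk_mono ltp) es; rewrite e2.
    move: nbw; rewrite /bad (proper_sub zx) negb_or => /andP[h1 h2]; split; last by rewrite (negPf h2).
    apply/idP/idP => [h|h]; first exact: subset_trans h (proper_sub zx).
    by rewrite h andbT negbK in h1.
  have xz := ev_gt (rk_mono ltp) es; rewrite e1.
  have nzx : (z \subset x) = false by apply: contraTF xz => h; rewrite properE h andbF.
  move: nbw; rewrite /bad nzx negb_or => /andP[h1 h2]; split; first by rewrite (negPf h2).
  apply/idP/idP => [h|h]; first exact: subset_trans (proper_sub xz) h.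
  by rewrite h andbT negbK in h1.
move=> [|i] [|j] hi hj /=.
- by rewrite lexx subxx.
- by case: (cmp j hj).
- by case: (cmp i hi).
- exact: IH.
Qed.

Lemma copy_weight_indep vs xs : leaf_order vs -> uniq vs -> (forall v, v \in vs) ->
  size xs = size vs -> copy_weight vs xs != 0 ->
  forall I : {set V}, independent P I -> exists2 x, x \in xs & x \notin I.
Proof.
move=> lo us all_vs sx w0 I ind.
apply/hasP; apply: contraT => /hasPn h; exfalso.
have ix v : (index v vs < size xs)%N by rewrite sx index_mem.
pose f v := nth set0 xs (index v vs).
have fle u v : (u <= v)%O = (f u \subset f v).
  rewrite -(copy_weight_induced lo sx w0 u) ?ix //.
  by rewrite !nth_index.
have finj : injective f.
  by move=> u v e; apply/le_anti; rewrite !fle e subxx.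
apply: (ind [set f v | v : P]).
  by apply/subsetP => _ /imsetP[v _ ->]; have := h _ (mem_nth set0 (ix v)); rewrite negbK.
split; first by rewrite card_imset.
by exists f.
Qed.

(** * Total weight of the copies *)

Section Lower.
Variables (a b k : nat) (beta eta : R).
Hypotheses (band : forall x, x \in G -> (a <= #|x| <= b)%N) (a_gt0 : (0 < a)%N) (b_lt : (b < n)%N).
Hypotheses (beta_up : (b - a)%:R <= beta * (n - b)%:R) (beta_down : (b - a)%:R <= beta * a%:R).
Hypotheses (rk_lt : forall v : P, (rk v < k)%N) (eta_ge0 : 0 <= eta).
Hypothesis L_rich : forall i j x, (i < k)%N -> (j < k)%N -> x \in L i ->
     eta * mu x <= \sum_(y in L j) Q i j x y.

Lemma bad_bound i j z w : i != j -> z \in G -> w \in G ->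
  \sum_(y | bad z w y) Q i j z y <= 2 * beta * mu z.
Proof.
by case: ltngtP => // ij _ zG wG; [apply: (bad_up band) | apply: (bad_down band)].
Qed.

(** Each extension keeps a factor [eta / 2]: the cleaned sets offer transition mass [eta * mu z],
    and each earlier vertex spoils at most [2 * beta * mu z] of it. *)
Lemma copy_weight_total vs (zeta : R) : leaf_order vs -> vs != [::] -> uniq vs ->
  (forall v : P, zeta <= \sum_(x in L (rk v)) mu x) ->
  2 * beta * (size vs)%:R <= eta / 2 ->
  zeta * (eta / 2) ^+ (size vs).-1 <= tsum (size vs) (copy_weight vs).
Proof.
move=> + + _ hz; elim: vs => [//|v vs IH] lo _ hb.
case: vs IH lo hb => [|v' vs] IH lo hb.
  rewrite mulr1; apply: le_trans (hz v) _; rewrite [leLHS]big_mkcond /tsum /=.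
  by apply: ler_sum => x _; case: (x \in _); rewrite ?mul1r ?mul0r.
case: lo => // -[lo _ hv _].
set vs' := v' :: vs in IH lo hv hb *.
have {}lo : leaf_order vs' := lo.
have e2 : 0 <= eta / 2 by rewrite divr_ge0.
have b0 : 0 <= beta by exact: (beta_ge0 a_gt0 beta_down).
apply: (@le_trans _ _ (psum (nseq (size vs') None) (fun xs => (eta / 2) * copy_weight vs' xs))).
  rewrite psumZ [size (v :: vs')]/= -[(_.+1).-1]/(size vs).+1 exprS mulrCA ler_wpM2l //.
  apply: IH => //; apply: le_trans hb; rewrite ler_wpM2l ?mulr_ge0 //.
  by rewrite ler_nat /=.
have -> : tsum (size (v :: vs')) (copy_weight (v :: vs')) =
  \sum_y psum (nseq (size vs') None) (fun xs => copy_weight (v :: vs') (y :: xs)) by [].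
rewrite -psum_sum; apply: ler_psum => xs /compat_size.
rewrite size_nseq => sx.
pose i := find (hasse_adj v) vs'; pose z := nth set0 xs i.
have -> : \sum_y copy_weight (v :: vs') (y :: xs) =
  \sum_y (y \in L (rk v))%:R * (copy_weight vs' xs * (link_ker v (par v vs') z y / mu z) *
    (all (fun w => ~~ bad z w y) xs)%:R) by [].
set W := copy_weight vs' xs.
have [->|W0] := eqVneq W 0.
  by rewrite mulr0; apply: sumr_ge0 => x _; rewrite !mul0r mulr0.
have Wge : 0 <= W by exact: copy_weight_ge0.
have hi : (i < size xs)%N by rewrite sx -has_find.
have [zG zL] := copy_weight_supp lo sx W0 hi.
have {}zL : z \in L (rk (par v vs')) by exact: zL.
have mz : 0 < mu z by rewrite mu_gt0.
set p := par v vs' in zL *.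
have rkne : rk p != rk v by apply: hasse_rk; exact: par_adj.
have -> : \sum_j (j \in L (rk v))%:R * (W * (link_ker v p z j / mu z) *
    (all (fun w => ~~ bad z w j) xs)%:R) =
   W / mu z * \sum_(j in L (rk v)) Q (rk p) (rk v) z j * (all (fun w => ~~ bad z w j) xs)%:R.
  rewrite mulr_sumr [RHS]big_mkcond /=; apply: eq_bigr => j _; rewrite /link_ker.
  case: (j \in _); rewrite ?mul0r ?mul1r //; ring.
rewrite [leLHS]mulrC -mulrA ler_wpM2l // [leRHS]mulrC ler_pdivlMr //.
have step : \sum_(y in L (rk v)) Q (rk p) (rk v) z y <=
   \sum_(j in L (rk v)) Q (rk p) (rk v) z j * (all (fun w => ~~ bad z w j) xs)%:R +
   \sum_(w <- xs) \sum_(y | bad z w y) Q (rk p) (rk v) z y.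
  rewrite [X in _ + X](eq_bigr (fun w => \sum_y (bad z w y)%:R * Q (rk p) (rk v) z y)).
    rewrite exchange_big /=.
    apply: (@le_trans _ _ (\sum_(j in L (rk v)) Q (rk p) (rk v) z j * (all (fun w => ~~ bad z w j) xs)%:R
       + \sum_(y in L (rk v)) \sum_(w <- xs) (bad z w y)%:R * Q (rk p) (rk v) z y)).
      rewrite -big_split /=; apply: ler_sum => y _.
      case: (boolP (all _ _)) => [_|/allPn[w wxs]].
        by rewrite mulr1 lerDl sumr_ge0 // => w _; rewrite mulr_ge0 ?Q_ge0.
      rewrite negbK => bw; rewrite mulr0 add0r (big_rem w) //= bw mul1r lerDl.
      by apply: sumr_ge0 => w' _; rewrite mulr_ge0 ?Q_ge0.
    rewrite lerD2l [leRHS](bigID (fun y => y \in L (rk v))) /= lerDl.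
    by apply: sumr_ge0 => y _; apply: sumr_ge0 => w _; rewrite mulr_ge0 ?Q_ge0.
  by move=> w _; rewrite [LHS]big_mkcond; apply: eq_bigr => y _; case: (bad _ _ _); rewrite ?mul1r ?mul0r.
have bound : \sum_(w <- xs) \sum_(y | bad z w y) Q (rk p) (rk v) z y <= eta / 2 * mu z.
  apply: (@le_trans _ _ (\sum_(w <- xs) 2 * beta * mu z)).
    rewrite !big_seq; apply: ler_sum => w wxs; apply: bad_bound => //.
    by have [] := copy_weight_supp lo sx W0 (i := index w xs); rewrite ?index_mem ?nth_index.
  rewrite big_const_seq count_predT iter_addr_0 -[leLHS]mulr_natr sx mulrAC ler_wpM2r ?(ltW mz) //.
  by apply: le_trans hb; rewrite ler_wpM2l ?mulr_ge0 // ler_nat /=.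
have := L_rich (rk_lt p) (rk_lt v) zL; lra.
Qed.

End Lower.
End CopyWeight.

(** * Container iteration *)

Section Step.
Local Open Scope ring_scope.
Variables (R : realFieldType) (d : Order.disp_t) (P : finPOrderType d).
Local Notation lub := (@lub R _).
Local Notation h := #|P|.
Local Notation k := (height P).

Definition in_band n a b (F : {set {set 'I_n}}) := forall x, x \in F -> (a <= #|x| <= b)%N.

Definition gap_bound n a b r (tau : R) := forall x y : {set 'I_n},
  (a <= #|x| <= b)%N -> (a <= #|y| <= b)%N -> x \subset y -> (#|x| + r <= #|y|)%N ->
  1 <= tau * 'C(n - #|x|, #|y| - #|x|)%:R /\ 1 <= tau * 'C(#|y|, #|x|)%:R.

Definition narrow n a b (beta : R) :=
  [/\ (0 < a)%N, (b < n)%N, (b - a)%:R <= beta * (n - b)%:R & (b - a)%:R <= beta * a%:R].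

Lemma sum_mu n (G S : {set {set 'I_n}}) : S \subset G -> \sum_(x in S) mu R G x = \sum_(x in S) lub x.
Proof. by move=> sub; apply: eq_bigr => x /(subsetP sub) /mu_in ->. Qed.

Lemma sum_mu_all n (G : {set {set 'I_n}}) : \sum_x mu R G x = \sum_(x in G) lub x.
Proof.
rewrite [RHS]big_mkcond; apply: eq_bigr => x _; rewrite /mu.
by case: (x \in G); rewrite ?mulr1 ?mulr0.
Qed.

Lemma supersaturation (eps : R) : tree_poset P -> 0 < eps ->
  exists beta zeta : R, [/\ 0 < beta, 0 < zeta &
  forall n a b r (tau : R) (G : {set {set 'I_n}}), narrow n a b beta -> in_band a b G ->
    0 < tau -> gap_bound n a b r tau ->
    (forall x y, x \in G -> y \in G -> x \proper y -> (#|x| + r <= #|y|)%N) ->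
  exists W : seq {set 'I_n} -> R,
  [/\ forall xs, 0 <= W xs, spread (mu R G) tau 1 h W,
      forall I, independent P I -> forall xs, size xs = h -> W xs != 0 ->
        exists2 x, x \in xs & x \notin I &
      k%:R - 1 + eps <= \sum_(x in G) lub x -> \sum_(x in G) lub x <= k%:R + 1 ->
      zeta <= tsum h W]].
Proof.
move=> tP e0; have [vs [lo us all_vs]] := exists_leaf_order tP.
have szh : size vs = h.
  by rewrite -(card_uniqP us); apply: eq_card => v; rewrite all_vs.
have h0 : (0 < h)%N by case: tP.
have vs0 : vs != [::] by rewrite -size_eq0 szh -lt0n.
have k0 : (0 < k)%N.
  by case/card_gt0P: h0 => v _; apply: leq_ltn_trans (rk_lt_height v).
have k0' : 0 < k%:R :> R by rewrite ltr0n.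
have h0' : 0 < h%:R :> R by rewrite ltr0n.
have k1' : 0 < k%:R + 1 :> R by rewrite addr_gt0.
(* For mass at most [k + 1], cleaning loses at most [eta * k * (k + 1) = eps / 2]. *)
pose eta := eps / (2 * k%:R * (k%:R + 1)).
have eta0 : 0 < eta by rewrite divr_gt0 ?mulr_gt0.
(* At most [h] earlier vertices spoil [2 * beta] each, together [eta / 2]. The cleaned mass left for
   the root is at least [eps / 2], and [h - 1] extensions follow. *)
exists (eta / (4 * h%:R)), (eps / 2 * (eta / 2) ^+ h.-1); split.
- by apply: divr_gt0 => //; apply: mulr_gt0.
- by apply: mulr_gt0; [|apply: exprn_gt0]; apply: divr_gt0.
move=> n a b r tau G [a0 bn nb na] band t0 gap sep.
have tb x y : x \in G -> y \in G -> x \proper y ->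
    1 <= tau * 'C(n - #|x|, #|y| - #|x|)%:R /\ 1 <= tau * 'C(#|y|, #|x|)%:R.
  by move=> xG yG xy; apply: gap; rewrite ?band ?proper_sub ?sep.
have [L [Lrich Lbig]] := cleaning G k0 (ltW eta0).
exists (copy_weight R G L vs); split.
- exact: copy_weight_ge0.
- by rewrite -szh; apply: (copy_weight_spread L t0 tb lo vs0).
- by move=> I ind xs sx w0; apply: (copy_weight_indep lo us all_vs _ w0 ind); rewrite szh.
move=> h1 h2; rewrite -szh.
apply: (copy_weight_total band a0 bn nb na (@rk_lt_height _ P) (ltW eta0) Lrich lo vs0 us).
  move=> v; apply: le_trans (Lbig _ (rk_lt_height v)).
  rewrite sum_mu_all.
  have : eta * k%:R * (\sum_(x in G) lub x) <= eta * k%:R * (k%:R + 1).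
    by rewrite ler_wpM2l // mulr_ge0 // ltW.
  have -> : eta * k%:R * (k%:R + 1) = eps / 2.
    by rewrite /eta; field; rewrite !gt_eqF.
  lra.
rewrite szh le_eqVlt; apply/orP; left; apply/eqP.
by field; rewrite gt_eqF.
Qed.

(** Deleting one set costs mass at most 1. This supplies the bound on the total mass, independent of
    [n], that the container lemma asks for. *)
Lemma shrink n (F : {set {set 'I_n}}) (t : R) : 0 <= t -> t <= \sum_(x in F) lub x ->
  exists2 G : {set {set 'I_n}}, G \subset F & t <= \sum_(x in G) lub x <= t + 1.
Proof.
move=> t0; have [m] := ubnP #|F|; elim: m F => // m IH F hm ht.
have [le|lt] := leP (\sum_(x in F) lub x) (t + 1); first by exists F; rewrite ?ht.
have [x xF] : exists x, x \in F.
  apply/set0Pn; apply: contraTneq lt => ->; rewrite big_set0 -leNgt addr_ge0 //.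
have e : \sum_(y in F) lub y = lub x + \sum_(y in F :\ x) lub y by rewrite (big_setD1 x).
have [||G sG hG] := IH (F :\ x).
- by move: hm; rewrite (cardsD1 x) xF.
- by have := lub_le1 R x; rewrite e in lt; lra.
- by exists G => //; apply: subset_trans sG (subD1set _ _).
Qed.

(** Pigeonhole over the sizes modulo [r]: comparable sets in one class differ in size by a positive
    multiple of [r]. *)
Lemma sparse_class n (F : {set {set 'I_n}}) r (t : R) : (0 < r)%N ->
  r%:R * t <= \sum_(x in F) lub x ->
  exists2 G : {set {set 'I_n}}, G \subset F & t <= \sum_(x in G) lub x /\
    (forall x y, x \in G -> y \in G -> x \proper y -> (#|x| + r <= #|y|)%N).
Proof.
move=> r0 ht.
pose cl (c : 'I_r) := [set x in F | (#|x| %% r == c)%N].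
have sub c : cl c \subset F by apply/subsetP => x; rewrite inE => /andP[].
have sep c x y : x \in cl c -> y \in cl c -> x \proper y -> (#|x| + r <= #|y|)%N.
  rewrite !inE => /andP[_ /eqP ex] /andP[_ /eqP ey] /proper_card lt.
  have dv : (r %| #|y| - #|x|)%N by rewrite -eqn_mod_dvd ?ex ?ey // ltnW.
  by have := dvdn_leq _ dv; rewrite subn_gt0 => /(_ lt); rewrite leq_subRL // ltnW.
case: (pickP (fun c => t <= \sum_(x in cl c) lub x)) => [c hc|hn].
  by exists (cl c) => //; split=> //; exact: sep.
exfalso; move: ht; rewrite leNgt => /negP; apply.
have -> : \sum_(x in F) lub x = \sum_c \sum_(x in cl c) lub x.
  rewrite (partition_big (fun x : {set 'I_n} => Ordinal (ltn_pmod #|x| r0)) xpredT) //=.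
  by apply: eq_bigr => c _; apply: eq_bigl => x; rewrite inE.
have -> : r%:R * t = \sum_(c < r) t by rewrite sumr_const card_ord mulr_natl.
apply: ltr_sum => [|c _]; last by rewrite ltNge hn.
by apply/hasP; exists (Ordinal r0) => //; rewrite mem_index_enum.
Qed.

Lemma fingerprint_step (eps : R) : tree_poset P -> 0 < eps -> eps <= 1 ->
  exists beta c K : R, [/\ 0 < beta, 0 < c, 0 < K &
  forall n a b r (tau : R) (F : {set {set 'I_n}}), narrow n a b beta -> in_band a b F ->
    (0 < r)%N -> 0 < tau -> tau <= 1 -> gap_bound n a b r tau ->
  exists (Tf : {set {set 'I_n}} -> seq {set {set 'I_n}})
         (Df : {set {set 'I_n}} -> {set {set 'I_n}}), forall I,
  [/\ size (Tf I) = h.-1 /\ (forall T, T \in Tf I ->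
         [/\ T \subset I, T \subset F & \sum_(x in T) lub x <= K * tau]),
     Df I \subset F,
     independent P I -> [disjoint Df I & I],
     forall I', Tf I = Tf I' -> Df I = Df I' &
     r%:R * (k%:R - 1 + eps) <= \sum_(x in F) lub x -> c <= \sum_(x in Df I) lub x]].
Proof.
move=> tP e0 e1; have [beta [zeta [b0 z0 H]]] := supersaturation tP e0.
have h0 : (0 < h)%N by case: tP.
have k0 : 0 < k%:R + 1 :> R by rewrite ltr_wpDl.
have [c [K [c0 K0 HC]]] := @container_step R h.-1 1 zeta (k%:R + 1) ltr01 z0 k0.
exists beta, c, K; split=> // n a b r tau F nar band r0 t0 t1 gap.
have [big|small] := leP (r%:R * (k%:R - 1 + eps)) (\sum_(x in F) lub x); last first.
  (* A family that is already small is left alone; empty parts keep the length of the fingerprint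
     constant, so that concatenations can be decoded. *)
  exists (fun=> nseq h.-1 set0), (fun=> set0) => I; split=> //.
  - split; first by rewrite size_nseq.
    move=> T; rewrite mem_nseq => /andP[_ /eqP->]; rewrite !sub0set big_set0; split=> //.
    by rewrite mulr_ge0 // ltW.
  - by rewrite sub0set.
  - by rewrite disjoints_subset sub0set.
have [G1 sG1 [hG1 sep1]] := sparse_class r0 big.
have km : 0 <= k%:R - 1 + eps.
  have : (1 <= k)%N by case/card_gt0P: h0 => v _; apply: leq_ltn_trans (rk_lt_height v).
  rewrite -(ler_nat R); lra.
have [G sG /andP[hG hG']] := shrink km hG1.
have sGF := subset_trans sG sG1.
have bandG : in_band a b G by move=> x /(subsetP sGF) /band.
have sep x y : x \in G -> y \in G -> x \proper y -> (#|x| + r <= #|y|)%N.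
  by move=> /(subsetP sG) h1 /(subsetP sG) h2; apply: sep1.
have [W [W0 Wsp Wind Wtot]] := H n a b r tau G nar bandG t0 gap sep.
have hk : \sum_(x in G) lub x <= k%:R + 1 by lra.
have mG : \sum_x mu R G x <= k%:R + 1 by rewrite sum_mu_all.
have hS : h.-1.+1 = h by rewrite prednK.
rewrite -hS in Wsp.
have [Tf [Df HT]] := HC _ (mu R G) tau W t0 t1 (@mu_ge0 R n G) mG W0 Wsp.
exists Tf, Df => I; have [[sT hT] hD hind hdet htot] := HT I.
have sD : Df I \subset G by apply/subsetP => x /hD; rewrite mu_gt0.
split=> //.
- split=> // T /hT[h1 h2].
  have sT' : T \subset G by apply/subsetP => x /h1[_]; rewrite mu_gt0.
  split; last by rewrite -(sum_mu sT').
    by apply/subsetP => x /h1[].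
  exact: subset_trans sT' sGF.
- exact: subset_trans sD sGF.
- move=> ind; rewrite disjoint_subset; apply/subsetP => x xD.
  by apply: hind xD => xs; rewrite hS; exact: Wind.
- by move=> _; rewrite -(sum_mu sD); apply: htot; rewrite hS; apply: Wtot.
Qed.

(** The constants do not depend on [r], [tau] or [M], so both regimes share them. Once [M * c]
    exceeds the initial mass, the second alternative is impossible and the container is small. *)
Lemma fingerprint_phase (eps : R) : tree_poset P -> 0 < eps -> eps <= 1 ->
  exists beta c K : R, [/\ 0 < beta, 0 < c, 0 < K &
  forall n a b r (tau : R), narrow n a b beta ->
    (0 < r)%N -> 0 < tau -> tau <= 1 -> gap_bound n a b r tau ->
  forall M (F : {set {set 'I_n}}), in_band a b F ->
  exists (Tf : {set {set 'I_n}} -> seq {set {set 'I_n}})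
         (Ff : {set {set 'I_n}} -> {set {set 'I_n}}), forall I,
  [/\ size (Tf I) = (M * h.-1)%N /\ (forall T, T \in Tf I ->
         [/\ T \subset I, T \subset F & \sum_(x in T) lub x <= K * tau]),
     Ff I \subset F,
     independent P I -> I :&: F \subset Ff I,
     forall I', Tf I = Tf I' -> Ff I = Ff I' &
     \sum_(x in Ff I) lub x < r%:R * (k%:R - 1 + eps) \/
     M%:R * c + \sum_(x in Ff I) lub x <= \sum_(x in F) lub x]].
Proof.
move=> tP e0 e1; have [beta [c [K [b0 c0 K0 H]]]] := fingerprint_step tP e0 e1.
exists beta, c, K; split=> // n a b r tau nar r0 t0 t1 gap.
elim=> [|M IH] F band.
  exists (fun=> [::]), (fun=> F) => I; split=> //; first by rewrite subsetIr.
  by right; rewrite mul0r add0r.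
have [T1 [D1 H1]] := H n a b r tau F nar band r0 t0 t1 gap.
have IH' (F' : {set {set 'I_n}}) : exists TF : ({set {set 'I_n}} -> seq {set {set 'I_n}}) *
    ({set {set 'I_n}} -> {set {set 'I_n}}), F' \subset F -> forall I,
  [/\ size (TF.1 I) = (M * h.-1)%N /\ (forall T, T \in TF.1 I ->
         [/\ T \subset I, T \subset F' & \sum_(x in T) lub x <= K * tau]),
     TF.2 I \subset F',
     independent P I -> I :&: F' \subset TF.2 I,
     forall I', TF.1 I = TF.1 I' -> TF.2 I = TF.2 I' &
     \sum_(x in TF.2 I) lub x < r%:R * (k%:R - 1 + eps) \/
     M%:R * c + \sum_(x in TF.2 I) lub x <= \sum_(x in F') lub x].
  have [sF|ns] := boolP (F' \subset F); last by exists (fun=> [::], fun=> set0).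
  have [|Tf [Ff HF]] := IH F'; first by move=> x /(subsetP sF) /band.
  by exists (Tf, Ff).
have [TF HTF] := choice IH'.
pose F1 I := F :\: D1 I.
exists (fun I => T1 I ++ (TF (F1 I)).1 I), (fun I => (TF (F1 I)).2 I) => I.
have sF1 : F1 I \subset F by exact: subsetDl.
have [[s1 h1] sD ind1 det1 big1] := H1 I.
have [[s2 h2] sF2 ind2 det2 big2] := HTF (F1 I) sF1 I.
split.
- split; first by rewrite size_cat s1 s2 mulSn.
  move=> T; rewrite mem_cat => /orP[/h1//|/h2[hI hF hs]].
  by split=> //; apply: subset_trans hF sF1.
- exact: subset_trans sF2 sF1.
- move=> ind; apply: subset_trans (ind2 ind); apply/subsetP => x.
  rewrite !inE => /andP[xI xF]; rewrite xI xF andbT /=.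
  by apply: contraTN xI => xD; have /pred0P/(_ x) := ind1 ind; rewrite /= xD => /= ->.
(* The lengths are known, so the concatenation splits uniquely: its head determines the next
   container, within which the tail is decoded. *)
- move=> I' /eqP; have [[s1' _] _ _ _ _] := H1 I'; rewrite eqseq_cat ?s1 //.
  case/andP=> /eqP e /eqP; have eF : F1 I' = F1 I by rewrite /F1 (det1 _ e).
  by rewrite eF => /det2.
- have e : \sum_(x in F) lub x = \sum_(x in D1 I) lub x + \sum_(x in F1 I) lub x.
    by rewrite (big_setID (D1 I)) /= (setIidPr sD).
  have [hb|hs] := leP (r%:R * (k%:R - 1 + eps)) (\sum_(x in F) lub x).
    case: big2 => [|h3]; first by left.
    by right; have := big1 hb; rewrite -natr1 mulrDl mul1r e; lra.
  left; apply: le_lt_trans hs; apply: ler_sum_subset; first exact: lub_ge0.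
  exact: subset_trans sF2 sF1.
Qed.

End Step.

(** * Binomial estimates *)

Section Binomials.

Lemma leq_bin_half n i j : i <= j -> j <= n./2 -> 'C(n, i) <= 'C(n, j).
Proof.
move=> ij; rewrite -(subnK ij); elim: (j - i) => // t IH.
rewrite addSn => h; apply: leq_trans (IH (ltnW h)) _.
have e := mul_bin_left n (t + i).
have h1 : (t + i).+1 <= n - (t + i) by lia.
have h2 : 0 < (t + i).+1 by [].
by rewrite -(leq_pmul2l h2) e leq_mul2r h1 orbT.
Qed.

Lemma leq_bin_middle n m : 'C(n, m) <= 'C(n, n./2).
Proof.
have [h|h] := leqP m n./2; first exact: leq_bin_half.
have [mn|nm] := leqP m n; last by rewrite bin_small.
by rewrite -bin_sub //; apply: leq_bin_half => //; lia.
Qed.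

Lemma leq_exp_ffact n r : (n - r) ^ r <= n ^_ r.
Proof.
elim: r => // r IH; rewrite ffactnSr expnSr; apply: leq_mul; last by lia.
by apply: leq_trans IH; case: r => // r; rewrite leq_exp2r //; lia.
Qed.

(** Up to level [n./2 - c], each step up multiplies the binomial coefficient by at least
    [(n./2 + c) / (n./2 - c)]. *)
Lemma bin_ratio n j t c : j + t + c <= n./2 ->
  (n./2 + c) ^ t * 'C(n, j) <= (n./2 - c) ^ t * 'C(n, j + t).
Proof.
elim: t j => [|t IH] j h; first by rewrite addn0.
have e := mul_bin_left n j.
have h1 : (n./2 + c) * 'C(n, j) <= (n./2 - c) * 'C(n, j.+1).
  apply: (@leq_trans ((n - j) * 'C(n, j))); first by rewrite leq_mul2r; apply/orP; right; lia.
  by rewrite -e leq_mul2r; apply/orP; right; lia.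
have h2 : (n./2 + c) ^ t * 'C(n, j.+1) <= (n./2 - c) ^ t * 'C(n, j.+1 + t) by apply: IH; lia.
rewrite addnS -addSn !expnSr -mulnA (leq_trans (leq_mul (leqnn _) h1)) //.
by rewrite mulnCA mulnC [X in _ <= X]mulnAC leq_mul2r h2 orbT.
Qed.

End Binomials.

(** * The central band of levels *)

Section Band.
Local Open Scope ring_scope.
Variable R : archiRealFieldType.

Definition lo_level L n := (n./2 - n %/ L)%N.
Definition hi_level L n := (n./2 + n %/ L)%N.

Lemma narrow_band L n (beta : R) : (16 <= L)%N -> (16 <= n)%N -> 16 <= beta * L%:R ->
  narrow n (lo_level L n) (hi_level L n) beta.
Proof.
move=> hL hn hb; rewrite /lo_level /hi_level; set q := (n %/ L)%N.
have hq : (L * q <= n)%N by rewrite mulnC leq_trunc_div.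
have hq' : (16 * q <= n)%N by apply: leq_trans hq; rewrite leq_mul2r hL orbT.
have L0 : 0 < L%:R :> R by rewrite ltr0n; lia.
have b0 : 0 < beta by rewrite -(pmulr_lgt0 _ L0); lra.
have key (t : nat) : (n <= 4 * t)%N -> (n./2 + q - (n./2 - q))%:R <= beta * t%:R :> R.
  move=> ht; have -> : (n./2 + q - (n./2 - q) = 2 * q)%N by lia.
  have h1 : (L * (2 * q))%:R <= (8 * t)%:R :> R by rewrite ler_nat; nia.
  move: h1; rewrite !natrM => h1.
  have t0 : 0 <= t%:R :> R by [].
  have h2 := ler_wpM2r t0 hb.
  rewrite -(ler_pM2l L0); nra.
split; [lia | lia | apply: key; lia | apply: key; lia].
Qed.

(** Both coefficients have the form C(m, g) with m >= n/4 and r <= g <= n/8, so they are at least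
    C(m, r) >= (n/8)^r / r!. *)
Lemma gap_bound_band L n r : (16 <= L)%N -> (16 <= n)%N -> (16 * r <= n)%N ->
  gap_bound n (lo_level L n) (hi_level L n) r (r`!%:R * 8 ^+ r / n%:R ^+ r : R).
Proof.
move=> hL hn hr x y; rewrite /lo_level /hi_level; set q := (n %/ L)%N.
have hq' : (16 * q <= n)%N.
  by apply: (@leq_trans (L * q)); [rewrite leq_mul2r hL orbT | rewrite mulnC leq_trunc_div].
move=> hx hy xy gap.
have n0 : 0 < n%:R :> R by rewrite ltr0n; lia.
have yn : (#|y| <= n)%N by have := max_card (mem y); rewrite card_ord.
have key m g : (n <= 4 * m)%N -> (r <= g)%N -> (8 * g <= n)%N ->
    1 <= r`!%:R * 8 ^+ r / n%:R ^+ r * 'C(m, g)%:R :> R.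
  move=> hm rg gn.
  have h1 : ('C(m, r) <= 'C(m, g))%N by apply: leq_bin_half => //; lia.
  have h2 : ((m - r) ^ r <= r`! * 'C(m, g))%N.
    apply: leq_trans (leq_exp_ffact m r) _; rewrite -bin_ffact mulnC leq_mul2l.
    by rewrite h1 orbT.
  have h3 : (n ^ r <= 8 ^ r * (r`! * 'C(m, g)))%N.
    apply: (@leq_trans (8 ^ r * (m - r) ^ r)); last by rewrite leq_mul2l h2 orbT.
    by rewrite -expnMn; case: (r) hr => // r' hr; rewrite leq_exp2r //; lia.
  have h4 : (n ^ r)%:R <= (8 ^ r * (r`! * 'C(m, g)))%:R :> R by rewrite ler_nat.
  rewrite mulrAC ler_pdivlMr ?exprn_gt0 // mul1r -natrX (le_trans h4) //.
  by rewrite !natrM natrX mulrA [8 ^+ r * _]mulrC.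
split; first by apply: key; lia.
rewrite -bin_sub; last by apply: subset_leq_card.
by apply: key; lia.
Qed.

Definition out_of_band L n : {set {set 'I_n}} :=
  [set x : {set 'I_n} | ~~ (lo_level L n <= #|x| <= hi_level L n)%N].

Lemma card_small_sets n m : (m <= n)%N ->
  #|[set x : {set 'I_n} | (#|x| <= m)%N]| = (\sum_(j < m.+1) 'C(n, j))%N.
Proof.
move=> mn; rewrite -sum1_card.
rewrite (partition_big (fun x : {set 'I_n} => inord #|x| : 'I_m.+1) xpredT) //=.
apply: eq_bigr => j _.
have -> : 'C(n, j) = 'C(#|'I_n|, j) by rewrite card_ord.
rewrite sum1_card -card_draws.
apply: eq_card => x; rewrite !inE unfold_in inE.
apply/andP/eqP => [[h /eqP <-]|e]; first by rewrite inordK.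
have h : (#|x| <= m)%N by rewrite e -ltnS.
by rewrite h; split=> //; apply/eqP/val_inj; rewrite /= inordK.
Qed.

Lemma small_sets_bound n e m : (m + 4 * e <= n./2)%N ->
  #|[set x : {set 'I_n} | (#|x| <= m)%N]|%:R * (n./2 + 2 * e)%:R ^+ (2 * e) <=
  n.+1%:R * 'C(n, n./2)%:R * (n./2 - 2 * e)%:R ^+ (2 * e) :> R.
Proof.
move=> h; have mn : (m <= n)%N by lia.
rewrite card_small_sets // -!natrX -!natrM ler_nat big_distrl /=.
apply: (@leq_trans (\sum_(j < m.+1) 'C(n, n./2) * (n./2 - 2 * e) ^ (2 * e))%N).
  apply: leq_sum => j _; have jm := ltn_ord j.
  rewrite mulnC; apply: leq_trans (@bin_ratio n j (2 * e) (2 * e) _) _; first by lia.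
  by rewrite mulnC leq_mul2r leq_bin_middle orbT.
by rewrite sum_nat_const card_ord -mulnA leq_mul2r ltnS mn orbT.
Qed.

(** Complementation sends the levels above the band to levels below it; the non-strict bound
    [<= lo_level L n] absorbs the rounding of [n./2]. *)
Lemma card_out_of_band L n : (16 <= L)%N -> (16 <= n)%N ->
  (#|out_of_band L n| <= 2 * #|[set x : {set 'I_n} | (#|x| <= lo_level L n)%N]|)%N.
Proof.
move=> hL hn; set S := [set x : {set 'I_n} | _].
have sub : out_of_band L n \subset S :|: (@setC 'I_n) @: S.
  apply/subsetP => x; rewrite !inE negb_and -!ltnNge => /orP[h|h]; first by rewrite ltnW.
  apply/orP; right; apply/imsetP; exists (~: x); last by rewrite setCK.
  by rewrite inE cardsCs setCK card_ord; move: h; rewrite /hi_level /lo_level; lia.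
apply: leq_trans (subset_leq_card sub) _; apply: leq_trans (leq_card_setU _ _) _.
by rewrite mul2n -addnn leq_add2l leq_imset_card.
Qed.

(** Bernoulli's inequality, squared. Growth quadratic in [e] is enough to beat the factor [n.+1]
    coming from the number of levels. *)
Lemma expr_quadratic (t : R) e : 0 <= t -> (e%:R * t) ^+ 2 <= (1 + t) ^+ (2 * e).
Proof.
move=> t0; rewrite mulnC exprM.
have h : e%:R * t <= (1 + t) ^+ e.
  have : 1 + e%:R * t <= (1 + t) ^+ e.
    elim: e => [|e IH]; first by rewrite mul0r addr0 expr0.
    have h2 : (1 + e%:R * t) * (1 + t) <= (1 + t) ^+ e * (1 + t).
      by rewrite ler_wpM2r // addr_ge0.
    have : 0 <= e%:R * t * t by rewrite !mulr_ge0.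
    rewrite exprSr -natr1; nra.
  by lra.
by rewrite lerXn2r // nnegrE ?mulr_ge0 // exprn_ge0 // addr_ge0.
Qed.

(** With [e] about n/(4L), [4 * e] levels fit between the edge of the band and the middle, and the
    last bound makes each of [2 * e] steps gain a factor [1 + 1/L]. *)
Lemma band_arith L n : (16 <= L)%N -> (16 * L <= n)%N ->
  exists e, [/\ (n <= 8 * L * e)%N, (lo_level L n + 4 * e <= n./2)%N, (2 * e < n./2)%N &
    (n./2 - 2 * e <= L * (4 * e))%N].
Proof.
move=> hL hn; exists (n %/ (4 * L))%N; set e := (_ %/ _)%N.
have he1 : (4 * L * e <= n)%N by rewrite mulnC leq_trunc_div.
have he2 : (n < 4 * L * e.+1)%N by rewrite mulnC; apply: ltn_ceil; rewrite muln_gt0 (leq_trans _ hL).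
have q4 : (4 * e <= n %/ L)%N by rewrite leq_divRL ?(leq_trans _ hL) //; lia.
have q16 : (16 * (n %/ L) <= n)%N.
  by apply: (@leq_trans (L * (n %/ L))); [rewrite leq_mul2r hL orbT | rewrite mulnC leq_trunc_div].
have he3 : (n <= 8 * L * e)%N by lia.
have n256 : (256 <= n)%N by lia.
have x1 : (lo_level L n + 4 * e <= n./2)%N.
  by rewrite /lo_level; clear -q4 q16; lia.
split=> //; first by clear -q4 q16 n256; lia.
have : (4 * L * e = L * (4 * e))%N by ring.
have : (8 * L * e = 2 * (L * (4 * e)))%N by ring.
move: he3; clear; lia.
Qed.

Lemma out_of_band_small L (eps : R) : (16 <= L)%N -> 0 < eps -> exists N : nat, forall n,
  (N <= n)%N -> #|out_of_band L n|%:R <= eps * 'C(n, n./2)%:R :> R.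
Proof.
move=> hL e0; have L0 : 0 < L%:R :> R by rewrite ltr0n; lia.
pose B := 256 * L%:R ^+ 4 / eps.
have B0 : 0 < B by rewrite divr_gt0 // mulr_gt0 // exprn_gt0.
exists (maxn (16 * L) (Num.bound B)) => n; rewrite geq_max => /andP[hn hB].
have Bn : B <= n%:R.
  apply: le_trans (ltW (archi_boundP (ltW B0))) _; by rewrite ler_nat.
have [e [he3 loE e2 he4]] := band_arith hL hn.
have n16 : (16 <= n)%N by apply: leq_trans hn; rewrite leq_pmulr // (leq_trans _ hL).
have h1 := small_sets_bound loE; set s := #|_|%:R in h1.
have h2 : #|out_of_band L n|%:R <= 2 * s :> R.
  by rewrite /s -natrM ler_nat card_out_of_band.
pose t : R := L%:R^-1.
have t0 : 0 < t by rewrite invr_gt0.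
set Cn := 'C(n, n./2)%:R in h1 *.
have C0 : 0 <= Cn by rewrite ler0n.
have A0 : 0 < (n./2 - 2 * e)%:R :> R.
  by rewrite ltr0n subn_gt0.
have key : s * (1 + t) ^+ (2 * e) <= n.+1%:R * Cn.
  have A0' : 0 < (n./2 - 2 * e)%:R ^+ (2 * e) :> R by rewrite exprn_gt0.
  rewrite -(ler_pM2r A0') (le_trans _ h1) // -mulrA -exprMn ler_wpM2l //.
  apply: lerXn2r; rewrite ?nnegrE ?mulr_ge0 ?addr_ge0 ?ler0n ?(ltW t0) ?(ltW A0) //.
  have h3 : ((n./2 - 2 * e)%:R : R) <= L%:R * (4 * e)%:R by rewrite -natrM ler_nat.
  rewrite -(ler_pM2l t0) mulrA [t * L%:R]mulVf ?gt_eqF // mul1r in h3.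
  have -> : (n./2 + 2 * e)%:R = (n./2 - 2 * e)%:R + (4 * e)%:R :> R.
    rewrite -natrD (_ : n./2 + 2 * e = n./2 - 2 * e + 4 * e)%N //.
    by move: e2; clear; lia.
  by rewrite mulrDl mul1r lerD2l.
have h3 : s * (e%:R * t) ^+ 2 <= n.+1%:R * Cn.
  apply: le_trans key; rewrite ler_wpM2l ?ler0n //; apply: expr_quadratic; exact: ltW.
have n0 : 0 < n%:R :> R by rewrite ltr0n (leq_trans _ n16).
have h4 : n%:R / (8 * L%:R) <= e%:R :> R.
  by rewrite ler_pdivrMr ?mulr_gt0 // mulrC -!natrM ler_nat.
have h5 : 64 * L%:R ^+ 4 * (e%:R * t) ^+ 2 >= n%:R ^+ 2.
  have -> : 64 * L%:R ^+ 4 * (e%:R * t) ^+ 2 = (8 * L%:R * e%:R) ^+ 2.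
    by rewrite /t; field; rewrite gt_eqF.
  rewrite lerXn2r // ?nnegrE ?ler0n ?mulr_ge0 ?ler0n //.
  by rewrite -!natrM ler_nat.
have s0 : 0 <= s by rewrite ler0n.
have h6 : s * n%:R ^+ 2 <= 64 * L%:R ^+ 4 * (n.+1%:R * Cn).
  apply: (@le_trans _ _ (s * (64 * L%:R ^+ 4 * (e%:R * t) ^+ 2))); first exact: ler_wpM2l.
  rewrite mulrCA ler_wpM2l // ?mulr_ge0 ?exprn_ge0 ?ler0n //.
have h7 : n.+1%:R <= 2 * n%:R :> R by rewrite -natrM ler_nat; move: n16; clear; lia.
have h8 : 256 * L%:R ^+ 4 <= eps * n%:R by move: Bn; rewrite /B ler_pdivrMr // [n%:R * _]mulrC.
have h9 : s * n%:R ^+ 2 <= (eps / 2 * Cn) * n%:R ^+ 2.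
  apply: (le_trans h6).
  apply: (@le_trans _ _ (64 * L%:R ^+ 4 * (2 * n%:R * Cn))).
    rewrite ler_wpM2l ?ler_wpM2r // mulr_ge0 ?exprn_ge0 ?ler0n //.
  have := ler_wpM2r (mulr_ge0 (ltW n0) C0) h8.
  rewrite expr2; lra.
have n2 : 0 < n%:R ^+ 2 :> R by rewrite exprn_gt0.
rewrite (ler_pM2r n2) in h9; lra.
Qed.

End Band.

(** * Counting fingerprints *)

Section Counting.
Variable V : finType.

(** Such a set is the range of a map from [t] points to [option V], its enumeration padded with
    [None]. *)
Lemma card_small_subsets t : #|[set S : {set V} | #|S| <= t]| <= #|V|.+1 ^ t.
Proof.
rewrite -card_option -{2}[t]card_ord -card_ffun.
pose im (f : {ffun 'I_t -> option V}) := [set x | [exists i, f i == Some x]].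
rewrite -[leqRHS]cardsT; apply: leq_trans (leq_imset_card im [set: _]).
apply: subset_leq_card; apply/subsetP => S; rewrite inE => hS; apply/imsetP.
exists [ffun i : 'I_t => nth None (map Some (enum S)) i] => //.
apply/setP => x; rewrite inE -mem_enum; apply/idP/existsP => [xS|[i]].
  have h : index x (enum S) < t by apply: leq_trans hS; rewrite cardE index_mem.
  by exists (Ordinal h); rewrite ffunE (nth_map x) ?index_mem //= nth_index.
rewrite ffunE; have [h|h] := ltnP i (size (enum S)).
  by rewrite (nth_map x) // => /eqP[<-]; exact: mem_nth.
by rewrite nth_default // size_map.
Qed.

Lemma card_small_families m t :
  #|[set f : {ffun 'I_m -> {set V}} | [forall i, #|f i| <= t]]| <= #|V|.+1 ^ (t * m).
Proof.
apply: (@leq_trans (#|[set S : {set V} | #|S| <= t]| ^ m)).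
  rewrite -[X in (_ ^ X)%N](card_ord m) -card_ffun_on; apply: subset_leq_card; apply/subsetP => f.
  by rewrite inE => /forallP h; apply/ffun_onP => i; rewrite inE.
by rewrite expnM; case: m => // m; rewrite leq_exp2r ?card_small_subsets.
Qed.

Local Open Scope ring_scope.
Variable R : realFieldType.

(* Weigh a family by [t ^ (size of its union)]; the sum of all weights factors over
   the points of [F]. *)
Lemma card_families_in (F : {set V}) m s (t : R) : 0 <= t -> t <= 1 ->
  #|[set f : {ffun 'I_m -> {set V}} | [forall i, f i \subset F] &&
      (#|\bigcup_i f i| <= s)%N]|%:R * t ^+ s <= (1 + 2 ^+ m * t) ^+ #|F|.
Proof.
move=> t0 t1; set D := [set f | _].
pose w x (A : {set 'I_m}) : R := if A == set0 then 1 else if x \in F then t else 0.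
have w0 x A : 0 <= w x A by rewrite /w; case: ifP => // _; case: ifP.
(* A family is transposed into the map sending a point to the indices of the parts containing it. A
   point of [F] then contributes one empty value of weight 1 and fewer than [2 ^ m] others of weight
   [t]. *)
pose tr (f : {ffun 'I_m -> {set V}}) : {ffun V -> {set 'I_m}} :=
  [ffun x => [set i | x \in f i]].
have tr_inj : injective tr.
  move=> f f' /ffunP e; apply/ffunP => i; apply/setP => x.
  by have := e x; rewrite !ffunE => /setP/(_ i); rewrite !inE.
have hw f : f \in D -> t ^+ s <= \prod_x w x (tr f x).
  rewrite inE => /andP[/forallP sF hs].
  have -> : \prod_x w x (tr f x) = \prod_(x in \bigcup_i f i) t.
    rewrite [RHS]big_mkcond; apply: eq_bigr => x _; rewrite /w ffunE.
    case: ifPn => [/eqP e|/set0Pn[i]].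
      case: ifPn => // /bigcupP[i _ xi]; exfalso.
      by move/setP/(_ i): e; rewrite !inE xi.
    rewrite inE => xi; rewrite (subsetP (sF i)) // ifT //.
    by apply/bigcupP; exists i.
  by rewrite prodr_const; apply: ler_wiXn2l.
rewrite mulr_natl -sumr_const.
apply: (@le_trans _ _ (\sum_(f in D) \prod_x w x (tr f x))); first exact: ler_sum.
apply: (@le_trans _ _ (\sum_(h in tr @: D) \prod_x w x (h x))).
  by rewrite big_imset //= => f f' _ _; exact: tr_inj.
apply: (@le_trans _ _ (\sum_(h : {ffun V -> {set 'I_m}}) \prod_x w x (h x))).
  by rewrite [leRHS](bigID (mem (tr @: D))) /= lerDl sumr_ge0 // => h _; apply: prodr_ge0.
rewrite -(bigA_distr_bigA w) /= -prodr_const [leRHS]big_mkcond /=.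
apply: ler_prod => x _; rewrite sumr_ge0 //=.
rewrite (bigD1 set0) //= /w eqxx.
rewrite (eq_bigr (fun=> if x \in F then t else 0)) => [|A /negPf->//].
case: ifP => _; last by rewrite big1 // addr0.
rewrite lerD2l sumr_const -[leLHS]mulr_natl ler_wpM2r // -natrX ler_nat.
by apply: leq_trans (max_card _) _; rewrite -cardsT -powersetT card_powerset cardsT card_ord.
Qed.

End Counting.

(** * Encoding fingerprints as vectors *)

Section Assembly.
Variables (d : Order.disp_t) (P : finPOrderType d) (n : nat).
Local Notation F := {set {set 'I_n}}.
Variables (T1 : F -> seq F) (F1 : F -> F) (T2 : F -> F -> seq F) (F2 : F -> F -> F).
Variables (out : F) (m1 m2 t1 : nat).
Hypotheses (size1 : forall I, size (T1 I) = m1) (size2 : forall I, size (T2 (F1 I) I) = m2).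
Hypothesis det1 : forall I I', T1 I = T1 I' -> F1 I = F1 I'.
Hypothesis det2 : forall I I', T2 (F1 I) I = T2 (F1 I) I' -> F2 (F1 I) I = F2 (F1 I) I'.
Hypothesis sub1 : forall I T, T \in T1 I -> T \subset I.
Hypothesis sub2 : forall I T, T \in T2 (F1 I) I -> T \subset I /\ T \subset F1 I.
Hypothesis small1 : forall I T, T \in T1 I -> #|T| <= t1.
Hypothesis cont : forall I, independent P I -> I \subset F2 (F1 I) I :|: out.

Definition data : finType :=
  ({ffun 'I_m1 -> {set {set 'I_n}}} * {ffun 'I_m2 -> {set {set 'I_n}}})%type.

Definition record I : data :=
  ([ffun i : 'I_m1 => nth set0 (T1 I) i], [ffun i : 'I_m2 => nth set0 (T2 (F1 I) I) i]).

Definition support (D : data) : F := (\bigcup_i D.1 i) :|: (\bigcup_i D.2 i).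

(* The trailing empty parts encode [D], so distinct data give distinct vectors. *)
Definition vec (D : data) : seq F := support D :: nseq (enum_rank D) set0.

Lemma vec_inj : injective vec.
Proof.
move=> D D' e; apply/enum_rank_inj/val_inj.
by have /(congr1 size) := e; rewrite /= !size_nseq => -[].
Qed.

Lemma hat_vec D : hatT (vec D) = support D.
Proof.
rewrite /hatT big_cons (_ : \bigcup_(A <- nseq _ _) A = set0) ?setU0 //.
by rewrite big_nseq; elim: (nat_of_ord _) => //= k ->; rewrite setU0.
Qed.

Lemma vec_disjoint D : pairwise_disjoint_vec (vec D).
Proof.
move=> i [|j] //= _; rewrite nth_nseq.
by case: ifP => _; rewrite disjoint_sym disjoints_subset sub0set.
Qed.

Lemma nth_ffun_inj m (s s' : seq F) : size s = m -> size s' = m ->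
  [ffun i : 'I_m => nth set0 s i] = [ffun i : 'I_m => nth set0 s' i] -> s = s'.
Proof.
move=> es es' /ffunP e; apply: (@eq_from_nth _ set0) => [|i hi]; first by rewrite es es'.
by rewrite es in hi; have := e (Ordinal hi); rewrite !ffunE.
Qed.

Lemma record_det1 I I' : (record I).1 = (record I').1 -> F1 I = F1 I'.
Proof. by move=> /(nth_ffun_inj (size1 _) (size1 _)) /det1. Qed.

Lemma record_det I I' : record I = record I' -> F2 (F1 I) I = F2 (F1 I') I'.
Proof.
move=> e; have e1 := record_det1 (congr1 fst e).
have := congr1 snd e; rewrite /= => /(nth_ffun_inj (size2 _) (size2 _)).
by rewrite -e1 => /det2.
Qed.

Lemma support_sub I : support (record I) \subset I.
Proof.
rewrite subUset; apply/andP; split; apply/bigcupsP => i _; rewrite ffunE.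
  by apply: sub1; rewrite mem_nth // size1.
by case: (@sub2 I (nth set0 (T2 (F1 I) I) i)); rewrite ?mem_nth ?size2.
Qed.

Lemma card_bigcup_nth m (s : seq F) : size s = m ->
  #|\bigcup_(i < m) [ffun i : 'I_m => nth set0 s i] i| <= \sum_(T <- s) #|T|.
Proof.
move=> <-; rewrite (big_nth set0) big_mkord; elim/big_ind2: _ => //; first by rewrite cards0.
  move=> p A q B hA hB; apply: leq_trans (leq_add hA hB).
  by have [] := leq_card_setU A B.
by move=> i _; rewrite ffunE.
Qed.

Lemma card_support I :
  #|support (record I)| <= \sum_(T <- T1 I) #|T| + \sum_(T <- T2 (F1 I) I) #|T|.
Proof.
apply: leq_trans (leq_card_setU _ _) _; apply: leq_add; exact: card_bigcup_nth.
Qed.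

Definition records : {set data} := [set record J | J in [set: F]].

Lemma assembly : exists (calT : seq (seq F)) (g : F -> seq F) (C : seq F -> F),
  [/\ fingerprint P calT g C,
    forall T, T \in calT -> exists I, #|hatT T| <= \sum_(T <- T1 I) #|T| + \sum_(T <- T2 (F1 I) I) #|T|,
    forall s, size [seq T <- calT | #|hatT T| == s] = #|[set D in records | #|support D| == s]| &
    forall I, C (g I) = F2 (F1 I) I :|: out].
Proof.
pose g I := vec (record I).
(* Any [J] with this vector will do, as the record determines the container. *)
pose C T := if [pick J | g J == T] is Some J then F2 (F1 J) J :|: out else set0.
have Cg I : C (g I) = F2 (F1 I) I :|: out.
  rewrite /C; case: pickP => [I' /eqP/vec_inj/record_det -> //|/(_ I)].
  by rewrite eqxx.
exists [seq vec D | D <- enum records], g, C; split=> //.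
- split; first by rewrite (map_inj_uniq vec_inj) enum_uniq.
  split; first by move=> T /mapP[D _ ->]; exact: vec_disjoint.
  move=> I ind; split; last by rewrite Cg cont.
    by apply/map_f; rewrite mem_enum; apply/imsetP; exists I.
  by rewrite /g hat_vec support_sub.
- move=> T /mapP[D]; rewrite mem_enum => /imsetP[I _ ->] ->.
  by exists I; rewrite hat_vec card_support.
- move=> s; rewrite filter_map size_map cardE; apply: perm_size.
  apply: uniq_perm => [||D]; [by apply: filter_uniq; exact: enum_uniq | exact: enum_uniq |].
  by rewrite mem_filter !mem_enum !inE /= hat_vec andbC.
Qed.

Local Open Scope ring_scope.

(** The first components are counted crudely through the sizes of their parts. Each of them fixes
    the container [F1 I], inside which the second components are counted by weights [t]. *)
Lemma card_records (R : realFieldType) s (t : R) N : 0 <= t -> t <= 1 ->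
  (forall I, (#|F1 I| <= N)%N) ->
  #|[set D in records | #|support D| == s]|%:R * t ^+ s <=
  (#|{set 'I_n}|.+1 ^ (t1 * m1))%:R * (1 + 2 ^+ m2 * t) ^+ N.
Proof.
move=> t0 t1' hN; set DS := [set D in records | _].
set A := [set f : {ffun 'I_m1 -> {set {set 'I_n}}} | [forall i, (#|f i| <= t1)%N]].
set B : R := (1 + 2 ^+ m2 * t) ^+ N.
have B1 : 1 <= 1 + 2 ^+ m2 * t by rewrite lerDl mulr_ge0 // exprn_ge0.
have B0 : 0 <= B by rewrite exprn_ge0 // (le_trans ler01).
apply: (@le_trans _ _ (\sum_(f in A) B)); last first.
  by rewrite sumr_const -[leLHS]mulr_natl ler_wpM2r // ler_nat card_small_families.
rewrite mulr_natl -sumr_const.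
rewrite (partition_big (fun D : data => D.1) (mem A)) /=; last first.
  move=> D; rewrite inE => /andP[/imsetP[I _ ->] _]; rewrite inE; apply/forallP => i.
  by rewrite ffunE; apply: (@small1 I); rewrite mem_nth // size1.
apply: ler_sum => f _.
have [/existsP[I /eqP eI]|/existsPn none] := boolP [exists I, (record I).1 == f]; last first.
  rewrite big1 // => D /andP[]; rewrite inE => /andP[/imsetP[I _ ->] _] h.
  by have := none I; rewrite h.
set X := [set h : {ffun 'I_m2 -> {set {set 'I_n}}} | [forall i, h i \subset F1 I] &&
      (#|\bigcup_i h i| <= s)%N].
apply: (@le_trans _ _ (#|X|%:R * t ^+ s)).
  rewrite (eq_bigl (fun D => D \in [set D in DS | D.1 == f])); last by move=> D; rewrite !inE.
  rewrite sumr_const -[leLHS]mulr_natl ler_wpM2r ?exprn_ge0 // ler_nat.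
  rewrite -(card_in_imset (f := snd)); last first.
    move=> [a b] [a' b']; rewrite !inE /= => /andP[_ /eqP->] /andP[_ /eqP->].
    by move=> ->.
  apply: subset_leq_card; apply/subsetP => h /imsetP[D].
  rewrite inE => /andP[]; rewrite inE => /andP[/imsetP[I' _ ->] /eqP hs] /eqP e ->.
  rewrite inE; apply/andP; split.
    have <- : F1 I' = F1 I by apply: record_det1; rewrite e.
    apply/forallP => i; rewrite ffunE.
    by case: (@sub2 I' (nth set0 (T2 (F1 I') I') i)); rewrite ?mem_nth ?size2.
  by rewrite -hs; apply: subset_leq_card; exact: subsetUr.
apply: le_trans (card_families_in (F1 I) m2 s t0 t1') _.
by apply: ler_weXn2l.
Qed.

End Assembly.

(** * Choice of the constants *)

Section Main.
Local Open Scope ring_scope.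
(* [E] stands for the exponential function. *)
Variables (R : archiRealFieldType) (E : R -> R).
Hypotheses (E_ge : forall x, 1 + x <= E x) (E_add : forall x y, E (x + y) = E x * E y).
Variables (d : Order.disp_t) (P : finPOrderType d).
Local Notation k := (height P).
Local Notation lub := (@lub R _).

Lemma E_ge0 x : 0 <= E x.
Proof.
have -> : x = x / 2 + x / 2 by field.
by rewrite E_add -expr2 sqr_ge0.
Qed.

Lemma E_mono x y : x <= y -> E x <= E y.
Proof.
move=> xy; have -> : y = x + (y - x) by ring.
rewrite E_add ler_peMr ?E_ge0 //; apply: le_trans (E_ge _); lra.
Qed.

Lemma E_nat x n : E (n%:R * x) = E x ^+ n.
Proof.
have E0 : E 0 = 1.
  have h := E_add 0 0; rewrite addr0 in h; have h1 := E_ge 0.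
  apply: (@mulIf _ (E 0)); [rewrite gt_eqF //; lra | by rewrite -h mul1r].
elim: n => [|n IH]; first by rewrite mul0r E0 expr0.
by rewrite -natr1 mulrDl mul1r E_add IH exprSr.
Qed.

Lemma expr_le_E x n : 0 <= x -> (1 + x) ^+ n <= E (n%:R * x).
Proof.
move=> x0; rewrite E_nat lerXn2r // ?nnegrE ?E_ge0 ?E_ge //; lra.
Qed.

Lemma card_le_lub n (S : {set {set 'I_n}}) (B : R) :
  \sum_(x in S) lub x <= B -> #|S|%:R <= B * 'C(n, n./2)%:R.
Proof.
move=> h; apply: (@le_trans _ _ (\sum_(x in S) lub x * 'C(n, n./2)%:R)); last first.
  by rewrite -mulr_suml ler_wpM2r.
rewrite -sum1_card natr_sum; apply: ler_sum => x _.
apply: (@le_trans _ _ (lub x * 'C(n, #|x|)%:R)); first by rewrite lubE.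
by rewrite ler_wpM2l ?lub_ge0 // ler_nat leq_bin_middle.
Qed.

Lemma sum_lub_le n (S : {set {set 'I_n}}) : \sum_(x in S) lub x <= n.+1%:R.
Proof.
rewrite -Ex_size_cG -(Ex_const n n.+1%:R); apply: ler_Ex => s.
by rewrite ler_nat size_cG.
Qed.

Lemma sum_card_le n (s : seq {set {set 'I_n}}) (B : R) :
  (forall T, T \in s -> #|T|%:R <= B) -> (\sum_(T <- s) #|T|)%:R <= (size s)%:R * B.
Proof.
elim: s => [|T s IH] h; first by rewrite big_nil mul0r.
rewrite big_cons natrD /= -natr1 mulrDl mul1r addrC lerD //.
  by apply: IH => T' hT'; apply: h; rewrite inE hT' orbT.
by apply: h; exact: mem_head.
Qed.

Lemma subsets_le_E n m (B : R) : m%:R * n.+1%:R <= B -> (#|{set 'I_n}|.+1 ^ m)%:R <= E B.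
Proof.
move=> hB; apply: le_trans (E_mono hB); rewrite -natrM -[(_ * _)%:R]mulr1 E_nat.
have -> : #|{set 'I_n}| = (2 ^ n)%N by rewrite -cardsT -powersetT card_powerset cardsT card_ord.
apply: (@le_trans _ _ (2 ^+ (m * n.+1))).
  rewrite -natrX ler_nat mulnC expnM; case: m {hB} => // m; rewrite leq_exp2r //.
  by rewrite expnS mul2n -addnn -addn1 leq_add2l expn_gt0.
by apply: lerXn2r; rewrite ?nnegrE ?E_ge0 //; apply: E_ge.
Qed.

Lemma counting_fingerprint (eps : R) : tree_poset P -> 0 < eps ->
  exists2 K : R, 0 < K & exists N : nat, forall n, (N <= n)%N ->
  exists (calT : seq (seq {set {set 'I_n}})) (g : {set {set 'I_n}} -> seq {set {set 'I_n}})
         (C : seq {set {set 'I_n}} -> {set {set 'I_n}}),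
  [/\ fingerprint P calT g C,
    forall T, T \in calT -> #|hatT T|%:R <= K / n%:R * 'C(n, n./2)%:R,
    forall s, (size [seq T <- calT | #|hatT T| == s])%:R <=
      (K * 'C(n, n./2)%:R / s%:R) ^+ s * E (K / n%:R * 'C(n, n./2)%:R) &
    forall I, independent P I -> #|C (g I)|%:R <= (k%:R - 1 + eps) * 'C(n, n./2)%:R].
Proof.
(* One [e] is for the container inside the band and one for the sets outside it; the minimum ensures
   [e <= 1]. *)
move=> tP eps0; pose e := Num.min eps 1 / 2.
have e0 : 0 < e by rewrite divr_gt0 // lt_min eps0 ltr01.
have [e1 e2] : e <= 1 /\ 2 * e <= eps.
  have : Num.min eps 1 <= 1 by rewrite ge_min lexx orbT.
  have : Num.min eps 1 <= eps by rewrite ge_min lexx.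
  by rewrite /e; lra.
have [beta [c [K0 [b0 c0 K00 H]]]] := fingerprint_phase tP e0 e1.
pose L := maxn 16 (Num.bound (16 / beta)).
have hL : (16 <= L)%N by rewrite leq_maxl.
have hbL : 16 <= beta * L%:R.
  rewrite mulrC -ler_pdivrMr //; apply: le_trans (ltW (archi_boundP _)) _.
    by rewrite divr_ge0 // ltW.
  by rewrite ler_nat leq_maxr.
have [N0 hN0] := out_of_band_small hL e0.
have k1 : 1 <= k%:R :> R.
  rewrite ler1n; case: tP => /card_gt0P[v _] _.
  exact: leq_ltn_trans (rk_lt_height v).
pose q : R := (#|P|.-1)%:R; have q0 : 0 <= q by rewrite ler0n.
(* The mass left by the first phase, which runs with [r = 5]: [5 * (k - 1 + e) <= U]. *)
pose U := 5 * k%:R : R; have U0 : 0 < U by rewrite /U; lra.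
pose A1 := 2 / c + 1; have A10 : 0 < A1 by rewrite addr_gt0 ?divr_gt0.
pose D : R := 5`!%:R * 8 ^+ 5.
have D0 : 0 < D by rewrite mulr_gt0 ?exprn_gt0 // ltr0n fact_gt0.
pose M2 := (Num.truncn (U / c)).+1.
have hM2 : U < M2%:R * c by rewrite -ltr_pdivrMr // truncnS_gt.
(* [KA] accounts for the sizes, from at most [A1 * n] steps at [tau1] and [M2] steps at [tau2]; [KB]
   for the logarithm of the number of first-phase records; [KN] dominates both the container mass
   and the fingerprint mass. *)
pose KA := K0 * q * (A1 * D + M2%:R * 8).
have KA0 : 0 <= KA by rewrite !mulr_ge0 ?addr_ge0 ?mulr_ge0 // ltW.
pose KB := 2 * K0 * D * A1 * q.
have KB0 : 0 <= KB by rewrite !mulr_ge0 // ltW.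
pose KN := U + KA + 1.
have [KN0 UKN KAKN] : [/\ 0 < KN, U <= KN & KA <= KN].
  by rewrite /KN; move: U0 KA0; clear -E_ge E_add P; split; lra.
pose m2 := (M2 * #|P|.-1)%N; pose EE := E (2 ^+ m2).
have EE0 : 0 <= EE by exact: E_ge0.
have KNE0 : 0 <= KN * EE by rewrite mulr_ge0 // ltW.
pose K := KA + KB + KN * EE + 1.
have [K_gt0 KA_K KB_K KN_K] : [/\ 0 < K, KA <= K, KB <= K & KN * EE <= K].
  by rewrite /K; move: KA0 KB0 KNE0; clear -E_ge E_add P; split; lra.
exists K => //; exists (maxn N0 (maxn 80 (Num.bound D))) => n.
rewrite !geq_max => /andP[hn0 /andP[hn80 hnD]].
set Cn : R := 'C(n, n./2)%:R; have Cn0 : 0 < Cn by rewrite ltr0n bin_gt0 -divn2 leq_div.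
have n16 : (16 <= n)%N by apply: leq_trans hn80.
have n1 : (0 < n)%N by apply: leq_trans hn80.
have n2 : (n.+1 <= 2 * n)%N by rewrite mul2n -addnn -addn1 leq_add2l.
have n0 : 0 < n%:R :> R by rewrite ltr0n.
pose u : R := n%:R^-1; have u0 : 0 < u by rewrite invr_gt0.
have un : u * n%:R = 1 by rewrite mulVf // gt_eqF.
have u1 : u <= 1 by rewrite invf_le1 // ler1n.
have uD : D * u <= 1.
  rewrite ler_pdivrMr // mul1r; apply: le_trans (ltW (archi_boundP (ltW D0))) _.
  by rewrite ler_nat.
have nar : narrow n (lo_level L n) (hi_level L n) beta by exact: narrow_band.
pose tau1 := D * u ^+ 5; pose tau2 := 8 * u.
have gap1 : gap_bound n (lo_level L n) (hi_level L n) 5 tau1.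
  by rewrite /tau1 exprVn; apply: gap_bound_band.
have gap2 : gap_bound n (lo_level L n) (hi_level L n) 1 tau2.
  have := @gap_bound_band R L n 1 hL; rewrite (_ : 1`!%:R = 1 :> R) // mul1r !expr1; apply; rewrite ?muln1 // n16.
have u4 : 0 <= u ^+ 4 <= 1 by rewrite exprn_ge0 ?exprn_ile1 // ltW.
have tau1_gt0 : 0 < tau1 by rewrite mulr_gt0 // exprn_gt0.
have tau1_le : tau1 <= D * u.
  by rewrite /tau1 exprS mulrA ler_piMr ?mulr_ge0 ?(ltW D0) ?(ltW u0) //; case/andP: u4.
have tau1_le1 : tau1 <= 1 by apply: le_trans uD.
have tau2_gt0 : 0 < tau2 by rewrite mulr_gt0.
have tau2_le1 : tau2 <= 1 by rewrite ler_pdivrMr // mul1r ler_nat (leq_trans _ hn80).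
(* The cube has mass at most [n + 1], so it cannot lose [c] this many times. *)
pose M1 := (Num.truncn (n.+1%:R / c)).+1; pose m1 := (M1 * #|P|.-1)%N.
have hM1 : n.+1%:R < M1%:R * c by rewrite -ltr_pdivrMr // truncnS_gt.
have M1A : M1%:R <= A1 * n%:R.
  have h1 : (Num.truncn (n.+1%:R / c))%:R <= n.+1%:R / c by rewrite truncn_le divr_ge0 // ltW.
  have h2 : n.+1%:R / c <= 2 / c * n%:R.
    by rewrite mulrAC ler_wpM2r ?invr_ge0 ?(ltW c0) // -natrM ler_nat.
  have h3 : 1 <= n%:R :> R by rewrite ler1n.
  by rewrite /M1 -natr1 /A1; move: h1 h2 h3; clear -E_ge E_add P; lra.
pose out := out_of_band L n; pose F0 := ~: out.
have band0 : in_band (lo_level L n) (hi_level L n) F0.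
  by move=> x; rewrite !inE negbK.
(* With gaps at least 5 the fingerprints of the first phase are so small that a
   trivial count of them suffices. *)
have [T1 [F1 H1]] := H n _ _ 5%N tau1 nar isT tau1_gt0 tau1_le1 gap1 M1 F0 band0.
have /choice[TF HTF] (F' : {set {set 'I_n}}) : exists TF : ({set {set 'I_n}} -> seq {set {set 'I_n}}) *
    ({set {set 'I_n}} -> {set {set 'I_n}}), F' \subset F0 -> forall I,
  [/\ size (TF.1 I) = (M2 * #|P|.-1)%N /\ (forall T, T \in TF.1 I ->
         [/\ T \subset I, T \subset F' & \sum_(x in T) lub x <= K0 * tau2]),
     TF.2 I \subset F',
     independent P I -> I :&: F' \subset TF.2 I,
     forall I', TF.1 I = TF.1 I' -> TF.2 I = TF.2 I' &
     \sum_(x in TF.2 I) lub x < 1%:R * (k%:R - 1 + e) \/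
     M2%:R * c + \sum_(x in TF.2 I) lub x <= \sum_(x in F') lub x].
  have [sF|ns] := boolP (F' \subset F0); last by exists (fun=> [::], fun=> set0).
  have [|Tf [Ff HF]] := H n _ _ 1%N tau2 nar isT tau2_gt0 tau2_le1 gap2 M2 F'.
    by move=> x /(subsetP sF) /band0.
  by exists (Tf, Ff).
have sF1 I : F1 I \subset F0 by have [] := H1 I.
have H2 I := HTF _ (sF1 I) I.
have F1_lub I : \sum_(x in F1 I) lub x <= U.
  have [_ _ _ _ [h|h]] := H1 I; first by rewrite /U; move: h e1 k1; clear -E_ge E_add P; lra.
  have := sum_lub_le F0; have : 0 <= \sum_(x in F1 I) lub x by apply: sumr_ge0 => x _; exact: lub_ge0.
  by move: h hM1; clear -E_ge E_add P; lra.
have F2_lub I : \sum_(x in (TF (F1 I)).2 I) lub x <= k%:R - 1 + e.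
  have [_ _ _ _ [h|h]] := H2 I; first by rewrite mul1r in h; exact: ltW.
  have := F1_lub I; have : 0 <= \sum_(x in (TF (F1 I)).2 I) lub x by apply: sumr_ge0 => x _; exact: lub_ge0.
  by move: h hM2; clear -E_ge E_add P; lra.
pose B1 := K0 * tau1 * Cn; pose B2 := K0 * tau2 * Cn.
have B10 : 0 <= B1 by rewrite !mulr_ge0 // ltW.
have T1_card I T : T \in T1 I -> #|T|%:R <= B1.
  by have [[_ h] _ _ _ _] := H1 I => /h[_ _]; exact: card_le_lub.
have T2_card I T : T \in (TF (F1 I)).1 I -> #|T|%:R <= B2.
  by have [[_ h] _ _ _ _] := H2 I => /h[_ _]; exact: card_le_lub.
pose t1 := Num.truncn B1.
have size1 I : size (T1 I) = m1 by have [[]] := H1 I.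
have size2 I : size ((TF (F1 I)).1 I) = m2 by have [[]] := H2 I.
have det1 I I' : T1 I = T1 I' -> F1 I = F1 I' by have [_ _ _ h _] := H1 I; exact: h.
have det2 I I' : (TF (F1 I)).1 I = (TF (F1 I)).1 I' -> (TF (F1 I)).2 I = (TF (F1 I)).2 I'.
  by have [_ _ _ h _] := H2 I; exact: h.
have sub1 I T : T \in T1 I -> T \subset I by have [[_ h] _ _ _ _] := H1 I => /h[].
have sub2 I T : T \in (TF (F1 I)).1 I -> T \subset I /\ T \subset F1 I.
  by have [[_ h] _ _ _ _] := H2 I => /h[].
have small1 I T : T \in T1 I -> (#|T| <= t1)%N by move=> /T1_card; rewrite truncn_ge_nat.
have cont I : independent P I -> I \subset (TF (F1 I)).2 I :|: out.
  move=> ind; have [_ _ h1 _ _] := H1 I; have [_ _ h2 _ _] := H2 I.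
  apply/subsetP => x xI; rewrite inE; have [//|xo] := boolP (x \in out); first by rewrite orbT.
  rewrite orbF; apply: (subsetP (h2 ind)); rewrite inE xI.
  by apply: (subsetP (h1 ind)); rewrite inE xI inE.
have [calT [g [C [fp hat cnt CE]]]] := @assembly _ P n T1 F1 (fun F' => (TF F').1)
  (fun F' => (TF F').2) out m1 m2 size1 size2 det1 det2 sub1 sub2 cont.
exists calT, g, C.
have m1q : m1%:R <= A1 * n%:R * q by rewrite natrM ler_wpM2r.
have hatB T : T \in calT -> #|hatT T|%:R <= KA * u * Cn.
  move=> /hat[I]; rewrite -(ler_nat R) natrD => hle; apply: (le_trans hle).
  have := sum_card_le (T1_card I); have := sum_card_le (T2_card I); rewrite size1 size2 => h2 h1.
  have h3 : m1%:R * B1 <= K0 * q * (A1 * D) * u * Cn.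
    apply: (@le_trans _ _ (A1 * n%:R * q * B1)); first by rewrite ler_wpM2r.
    have -> : A1 * n%:R * q * B1 = K0 * q * (A1 * D) * u * Cn * ((u * n%:R) * u ^+ 3).
      by rewrite /B1 /tau1; ring.
    rewrite un mul1r ler_piMr ?exprn_ile1 ?(ltW u0) //.
    by rewrite !mulr_ge0 // ltW.
  have h4 : m2%:R * B2 = K0 * q * (M2%:R * 8) * u * Cn.
    by rewrite /m2 natrM /B2 /tau2 -/q; ring.
  have -> : KA * u * Cn = K0 * q * (A1 * D) * u * Cn + K0 * q * (M2%:R * 8) * u * Cn.
    by rewrite /KA; ring.
  by move: h1 h2 h3 h4; clear -E_ge E_add P; lra.
split=> //.
- move=> T /hatB h; apply: (le_trans h); rewrite -/u !ler_wpM2r // ?(ltW Cn0) ?(ltW u0) //.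
- move=> s; rewrite -/u.
  have EK : E (KB * u * Cn) <= E (K * u * Cn).
    by apply: E_mono; rewrite !ler_wpM2r ?(ltW Cn0) ?(ltW u0).
  (* A nonzero count exhibits a fingerprint of size [s], which bounds [s] and so gives [t <= 1]
     below. *)
  have [c0'|cpos] := posnP (size [seq T <- calT | #|hatT T| == s]).
    rewrite c0' mulr_ge0 ?E_ge0 // exprn_ge0 // divr_ge0 ?ler0n // mulr_ge0 // ltW //.
  have sKA : s%:R <= KA * u * Cn.
    case E1 : [seq T <- calT | #|hatT T| == s] cpos => [//|T l] _.
    have : T \in [seq T <- calT | #|hatT T| == s] by rewrite E1 mem_head.
    by rewrite mem_filter => /andP[/eqP <-]; exact: hatB.
  have sKN : s%:R <= KN * Cn.
    apply: le_trans sKA _; rewrite ler_wpM2r ?(ltW Cn0) //.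
    by apply: (@le_trans _ _ KA); [rewrite ler_piMr | exact: KAKN].
  pose N2 := Num.truncn (U * Cn).
  have UC0 : 0 <= U * Cn by rewrite mulr_ge0 // ltW.
  have hN2 I : (#|F1 I| <= N2)%N by rewrite truncn_ge_nat //; apply: card_le_lub.
  have N2U : N2%:R <= U * Cn by rewrite truncn_le.
  (* With this weight [N2 * t <= s], so the generating function is at most [EE ^+ s], while dividing
     by [t ^+ s] produces the required power of [Cn / s]. *)
  pose t : R := s%:R / (KN * Cn).
  have KC0 : 0 < KN * Cn by rewrite mulr_gt0.
  have t0 : 0 <= t by rewrite divr_ge0 // ltW.
  have t1' : t <= 1 by rewrite ler_pdivrMr // mul1r.
  have := card_records (T2 := fun F' => (TF F').1) size1 size2 det1 sub2 small1 s t0 t1' hN2.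
  rewrite -cnt; set X := (size _)%:R; set Y := (_ ^ _)%:R => hX.
  have hY : Y <= E (KB * u * Cn).
    apply: subsets_le_E; rewrite natrM.
    have tB : t1%:R <= B1 by rewrite truncn_le.
    apply: (@le_trans _ _ (B1 * (A1 * n%:R * q) * (2 * n%:R))).
      apply: ler_pM; rewrite ?mulr_ge0 ?ler0n //; last by rewrite -natrM ler_nat.
      by apply: ler_pM; rewrite ?ler0n.
    (* Parts have size of order [u ^+ 5 * Cn], there are O(n) of them, and naming one set takes O(n)
       bits: the exponent is of order [u ^+ 3 * Cn], below [u * Cn]. *)
    have -> : B1 * (A1 * n%:R * q) * (2 * n%:R) = KB * u * Cn * ((u * n%:R) ^+ 2 * u ^+ 2).
      by rewrite /B1 /tau1 /KB; ring.
    rewrite un expr1n mul1r ler_piMr ?exprn_ile1 ?(ltW u0) //.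
    by rewrite !mulr_ge0 // ltW.
  have hE : (1 + 2 ^+ m2 * t) ^+ N2 <= EE ^+ s.
    rewrite /EE -E_nat; apply: le_trans (expr_le_E _ _) _; first by rewrite mulr_ge0 ?exprn_ge0.
    apply: E_mono; rewrite mulrCA [leRHS]mulrC ler_wpM2l ?exprn_ge0 //.
    rewrite /t mulrA ler_pdivrMr // mulrC ler_wpM2l //.
    by apply: le_trans N2U _; rewrite ler_wpM2r ?(ltW Cn0).
  have Y0 : 0 <= Y by rewrite ler0n.
  have hXt : X * t ^+ s <= E (K * u * Cn) * EE ^+ s.
    apply: (le_trans hX); apply: ler_pM => //; last exact: le_trans EK.
    by rewrite exprn_ge0 // addr_ge0 // mulr_ge0 // exprn_ge0.
  (* For [s = 0] the weight [t] is 0 and cannot be divided by, but all the powers are 1. *)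
  have [s0|spos] := posnP s.
    by move: hXt; rewrite s0 !expr0 !mulr1 mul1r.
  have tpos : 0 < t by rewrite divr_gt0 // ltr0n.
  have X_le : X <= (EE / t) ^+ s * E (K * u * Cn).
    by rewrite expr_div_n mulrAC ler_pdivlMr ?exprn_gt0 // [EE ^+ s * _]mulrC.
  apply: (le_trans X_le); rewrite ler_wpM2r ?E_ge0 // lerXn2r ?nnegrE //.
  + by rewrite divr_ge0.
  + by rewrite divr_ge0 ?ler0n // mulr_ge0 // ltW.
  rewrite /t invf_div mulrA ler_wpM2r ?invr_ge0 ?ler0n // mulrA ler_wpM2r ?(ltW Cn0) //.
  by rewrite mulrC.
- move=> I ind; rewrite CE.
  have h1 := card_le_lub (F2_lub I); have h2 := hN0 n hn0.
  have h3 : #|(TF (F1 I)).2 I :|: out|%:R <= #|(TF (F1 I)).2 I|%:R + #|out|%:R :> R.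
    by rewrite -natrD ler_nat; have [] := leq_card_setU ((TF (F1 I)).2 I) out.
  apply: (le_trans h3); apply: (@le_trans _ _ ((k%:R - 1 + e) * Cn + e * Cn)); first exact: lerD.
  by rewrite -mulrDl ler_wpM2r ?(ltW Cn0) //; move: e2; clear -E_ge E_add P; lra.
Qed.

End Main.

(** * Specialisation to the real exponential *)

Lemma exp_ge_affine (x : Rdefinitions.R) : (1 + x <= Rtrigo_def.exp x)%R.
Proof. by apply/RleP; exact: Rpower.exp_ineq1_le. Qed.

From Stdlib Require Import Reals.

Theorem theorem6p4 (d : Order.disp_t) (P : finPOrderType d) (k : nat) (eps : R) :
  tree_poset P -> height P = k -> (2 <= k)%N -> (0 < eps)%R ->
  exists K : R, (0 < K)%R /\
  exists N : nat, forall n : nat, (N <= n)%N ->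
  exists (calT : seq (seq {set {set 'I_n}}))
         (g : {set {set 'I_n}} -> seq {set {set 'I_n}})
         (C : seq {set {set 'I_n}} -> {set {set 'I_n}}),
    fingerprint P calT g C /\
    (forall T, T \in calT ->
       (INR #|hatT T| <= K / INR n * INR 'C(n, n./2))%R) /\
    (forall s : nat,
       (INR (size [seq T <- calT | #|hatT T| == s])
        <= (K * INR 'C(n, n./2) / INR s) ^ s * exp (K / INR n * INR 'C(n, n./2)))%R) /\
    (forall I : {set {set 'I_n}}, independent P I ->
       (INR #|C (g I)| <= (INR k - 1 + eps) * INR 'C(n, n./2))%R).
Proof.
move=> tP hk _ /RltP eps0.
have [K K0 [N H]] := counting_fingerprint exp_ge_affine (fun x y => esym (expRD x y)) tP eps0.
exists K; split; first exact/RltP.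
exists N => n hn; have [calT [g [C [fp h1 h2 h3]]]] := H n hn.
exists calT, g, C; split; first exact: fp.
split; first by move=> T /h1 h; rewrite !INRE; apply/RleP.
split; first by move=> s; rewrite RpowE !INRE; apply/RleP; exact: h2.
by move=> I /h3 h; rewrite !INRE; apply/RleP; rewrite -hk.
Qed.
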